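(* Let $G$ be a non-elementary group admitting a proper isometric action on a proper geodesic metric space $(\mathrm Y,d)$ with a contracting element. If $G$ has purely exponential growth, then the set of contracting elements is generic.
   Context: Setting: $G$ is a countable group acting properly by isometries on a proper geodesic metric space $(\mathrm Y,d)$; $o\in \mathrm Y$ is a fixed basepoint. $G$ is non-elementary if it has no finite-index cyclic subgroup (the trivial group counts as cyclic). Growth: $N(o,n)=\{g\in G: d(o,go)\le n\}$ and $\omega(G)=\limsup_{n\to\infty}\frac{\log \sharp N(o,n)}{n}$. $G$ (i.e. its action) has purely exponential growth if $\sharp N(o,n)\asymp\exp(\omega(G)n)$, i.e. the ratio of the two sides is bounded above and below by positive constants. A subset $X\subset G$ is generic if $\sharp(N(o,n)\cap X)/\sharp N(o,n)\to 1$ as $n\to\infty$. Contracting elements: for $X\subset \mathrm Y$ and $y\in\mathrm Y$, $\pi_X(y)$ is the set of $x\in X$ with $d(y,x)=d(y,X)$, and $\pi_X(A)=\bigcup_{a\in A}\pi_X(a)$. For $C\ge 1$, $X$ is $C$-contracting if every geodesic $\gamma$ with $d(\gamma,X)\ge C$ satisfies $\mathrm{diam}(\pi_X(\gamma))\le C$; $X$ is contracting if it is $C$-contracting for some $C$. An element $h\in G$ is contracting if $\langle h\rangle\cdot o$ is a contracting subset and $n\in\mathbb Z\mapsto h^no\in\mathrm Y$ is a quasi-isometric embedding. *)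

(* Defs.v *)
From HB Require Import structures.
From mathcomp Require Import all_boot all_order all_algebra.
From mathcomp Require Import finmap.
From mathcomp Require Import all_classical all_reals all_analysis.

Set Implicit Arguments.
Unset Strict Implicit.
Unset Printing Implicit Defensive.

Import Order.TTheory GRing.Theory Num.Theory.
Import numFieldNormedType.Exports.

Local Open Scope classical_set_scope.
Local Open Scope ring_scope.

Section Groups.
Context {G : groupType}.
Implicit Types (h : G) (H : set G).

Definition zpow h (n : int) : G :=
  match n with
  | Posz k => (h ^+ k)%g
  | Negz k => (h ^- k.+1)%g
  end.

Definition cyclic_subgroup h : set G := range (zpow h).

Definition finite_index H : Prop :=
  finite_set (range (fun g : G => [set (g * x)%g | x in H])).

End Groups.

Definition non_elementary (G : groupType) : Prop :=
  forall h : G, ~ finite_index (cyclic_subgroup h).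

Section MetricSpaces.
Context {R : realType} {Y : metricType R}.
Implicit Types (x y : Y) (A B X : set Y) (C : R).

(* Values in \bar R: the distance to the empty set is +oo, and the diameter
   of the empty set is -oo. *)
Definition dist_pt_set y X : \bar R := ereal_inf [set (mdist y x)%:E | x in X].

Definition dist_set A B : \bar R := ereal_inf [set dist_pt_set a B | a in A].

Definition diam A : \bar R :=
  ereal_sup [set (mdist p.1 p.2)%:E | p in A `*` A].

(* [gamma] is only relevant on [I], which may be bounded or not: segments,
   rays and lines are all covered. *)
Definition geodesic_on (I : set R) (gamma : R -> Y) : Prop :=
  [/\ is_interval I, I !=set0 &
      forall s t, I s -> I t -> mdist (gamma s) (gamma t) = `|s - t|].

Definition nearest_proj X y : set Y :=
  [set x | X x /\ (mdist y x)%:E = dist_pt_set y X].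

Definition nearest_proj_set X A : set Y := \bigcup_(a in A) nearest_proj X a.

Definition C_contracting_set C X : Prop :=
  forall (I : set R) (gamma : R -> Y), geodesic_on I gamma ->
    (C%:E <= dist_set (gamma @` I) X)%E ->
    (diam (nearest_proj_set X (gamma @` I)) <= C%:E)%E.

Definition contracting_set X : Prop :=
  exists C : R, 1 <= C /\ C_contracting_set C X.

Definition qi_embedding_int (f : int -> Y) : Prop :=
  exists lambda c : R, [/\ 1 <= lambda, 0 <= c &
    forall m n : int,
      lambda^-1 * `|m - n|%:~R - c <= mdist (f m) (f n)
        <= lambda * `|m - n|%:~R + c].

End MetricSpaces.

(* The library's [closed_ball] is the closure of the open ball, hence the
   explicit set. *)
Definition proper_space (R : realType) (Y : metricType R) : Prop :=
  forall (x : Y) (r : R), compact [set y : Y | mdist x y <= r].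

Definition geodesic_space (R : realType) (Y : metricType R) : Prop :=
  forall x y : Y, exists gamma : R -> Y,
    [/\ geodesic_on `[0, mdist x y] gamma, gamma 0 = x &
        gamma (mdist x y) = y].

Section Actions.
Context {R : realType} {Y : metricType R} {G : groupType}.
Implicit Types (act : G -> Y -> Y) (o : Y) (h : G) (S : set G).

Definition isometric_action act : Prop :=
  [/\ forall y, act 1%g y = y,
      forall g h y, act (g * h)%g y = act g (act h y) &
      forall g x y, mdist (act g x) (act g y) = mdist x y].

Definition proper_action act : Prop :=
  forall K : set Y, compact K ->
    finite_set [set g | (act g @` K) `&` K !=set0].

Definition orbit_ball act o (n : nat) : set G :=
  [set g | mdist o (act g o) <= n%:R].

(* [fset_set S] is empty when [S] is infinite, so this is the cardinality of
   finite sets only; orbit balls of a proper action on a proper space are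
   finite. *)
Definition ncard S : nat := #|` fset_set S|.

Definition growth_rate act o : \bar R :=
  limn_esup (fun n : nat => (ln (ncard (orbit_ball act o n))%:R / n%:R : R)%:E).

(* With [expeR], an infinite growth rate is never purely exponential. *)
Definition purely_exponential_growth act o : Prop :=
  exists c1 c2 : R, [/\ 0 < c1, 0 < c2 & forall n : nat,
    (c1%:E * expeR (growth_rate act o * n%:R%:E)
       <= (ncard (orbit_ball act o n))%:R%:E
       <= c2%:E * expeR (growth_rate act o * n%:R%:E))%E].

Definition generic act o S : Prop :=
  ((ncard (orbit_ball act o n `&` S))%:R
     / (ncard (orbit_ball act o n))%:R : R) @[n --> \oo] --> (1 : R).

Definition contracting_element act o h : Prop :=
  contracting_set [set act g o | g in cyclic_subgroup h] /\
  qi_embedding_int (fun n : int => act (zpow h n) o).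

End Actions.

(* Main.v *)
Require Import Defs.
From mathcomp Require Import all_boot all_order all_algebra.
From mathcomp Require Import finmap.
From mathcomp Require Import all_classical all_reals all_analysis.
From mathcomp Require Import ring lra zify.

Set Implicit Arguments.
Unset Strict Implicit.
Unset Printing Implicit Defensive.

Import Order.TTheory GRing.Theory Num.Theory.
Import numFieldNormedType.Exports.

Local Open Scope classical_set_scope.
Local Open Scope ring_scope.

(** Write |g| for the distance from o to g o, fix a contracting element f and
let w be the growth rate.

The axis of f.  The orbit of <f> satisfies a projection inequality: if the
nearest points p, q of x, y on it are far apart, then d(x,y) is, up to a
constant, d(x,p) + d(p,q) + d(q,y).  This inequality is equivalent to the
contracting property ([contracting_projection_ineq],
[projection_ineq_contracting]) and forces the orbit to be a line up to a
constant, so that every point of the space has a height and a real coordinate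
with respect to each translate of the axis ([contracting_coordinates]).  From
there on all the geometry is linear arithmetic with these coordinates.

Chains of axes.  An element b is a link if the axis and its translate by b are
seen from each other at the right ends of a long segment o, f^N o.  Coordinates
then propagate along a chain of links ([link_forward], [link_backward]), hence
such a chain is a coarse geodesic, and a conjugate of a link is contracting
([link_contracting]).

Genericity.  Let t o, t f^N o be close to a geodesic from o to g o, with |t| at
most |g|/2 minus a constant.  Then t^-1 g t is a link, and so g is contracting,
unless the end of the geodesic backtracks along its beginning; in that case g =
t k t^-1 with |k| <= |g| - 2|t| up to a constant ([conjugator_dichotomy]).
By pure exponential growth, the elements of the last kind in the ball of radius
n, with |t| >= m, number at most a constant times exp(w(n-m)).

What is left are the elements g whose geodesic has no such barrier t with
m <= |t|.  They split as g = t1 u h almost without loss of length, with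
|t1| < m, with u free of barriers, and |u| at least about |g|/2 - m
([barrier_free_decomposition]).  Now the sum of exp(-w|u|) over all
barrier-free u converges ([barrier_free_convergent]): any word in such elements
can be spelled with powers f^N inserted, after a bounded correction, so that it
becomes a chain of links ([link_insertion]); the spelling is unique up to a
bounded ambiguity, because of the absence of barriers; so a divergent sum would
give words more elements than the growth of G allows.  The tail of a convergent
sum being small, elements g of this kind are negligible too
([splitting_count]). *)

(** * Real numbers and integers *)

Lemma normP (R : realDomainType) (x : R) :
  (0 <= x /\ `|x| = x) \/ (x <= 0 /\ `|x| = - x).
Proof.
by case: (ger0P x) => [x0|/ltW x0]; [left|right].
Qed.

Ltac norm_cases :=
  repeat match goal with
  | H : context [ `|?x| ] |- _ =>
      let E := fresh "E" in
      let P := fresh "P" in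
      case: (normP x) => [[P E]|[P E]]; rewrite ?E in H *; clear E
  | |- context [ `|?x| ] =>
      let E := fresh "E" in
      let P := fresh "P" in
      case: (normP x) => [[P E]|[P E]]; rewrite ?E; clear E
  end.

Lemma exists_nat_gt (R : archiRealDomainType) (x : R) : exists n : nat, x < n%:R.
Proof. by exists (Num.trunc x).+1; exact: truncnS_gt. Qed.

(** * Contracting sequences and the projection inequality *)

Section Contraction.
Context {R : realType} {Y : metricType R}.
Implicit Types (x y z : Y) (e : int -> Y).

Definition nearest e y (m : int) : Prop :=
  forall n, mdist y (e m) <= mdist y (e n).

(** The lower half of a quasi-isometric embedding; it makes nearest indices
exist. *)
Definition spread e : Prop :=
  exists lam c : R, 0 < lam /\
    forall m n : int, lam * `|m - n|%:~R - c <= mdist (e m) (e n).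

(** A metric form of the contracting property that mentions no geodesic: going
from [x] to [y] costs a detour through the two projections as soon as these are
more than [K] apart. *)
Definition projection_ineq (K : R) e : Prop :=
  forall x y m n, nearest e x m -> nearest e y n -> K < mdist (e m) (e n) ->
    mdist x (e m) + mdist (e m) (e n) + mdist (e n) y <= mdist x y + K.

(** Indices beyond a bound [M] depending on [y] lie further from [y] than the
index 0, so that the minimum is taken over finitely many indices. *)
Lemma nearest_exists e : spread e -> forall y, exists m, nearest e y m.
Proof.
move=> [lam [c [lam0 He]]] y.
have [M HM] : exists M : nat, c + 2 * mdist y (e 0) < lam * M%:R.
  have [M HM] := exists_nat_gt ((c + 2 * mdist y (e 0)) / lam).
  by exists M; rewrite [lam * _]mulrC -ltr_pdivrMr.
pose F (i : 'I_(M + M).+1) : R := mdist y (e (i%:Z - M%:Z)).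
case: (@arg_minP _ _ _ (inord M) xpredT F isT) => i _ Hi.
exists (i%:Z - M%:Z) => n.
have [nM|Mn] := leqP `|n| M.
  have lt : (absz (n + M%:Z)%R < (M + M).+1)%N by lia.
  have := Hi (Ordinal lt) isT; rewrite /F /=.
  suff -> : (absz (n + M%:Z))%:Z - M%:Z = n by [].
  lia.
have lt : (M < (M + M).+1)%N by lia.
have := Hi (Ordinal lt) isT; rewrite /F /= subrr.
have := He 0 n; have := metric_triangle (e 0) y (e n); rewrite (metric_sym (e 0) y).
have : lam * M%:R <= lam * `|0 - n|%:~R.
  rewrite ler_pM2l // sub0r normrN -abszE -pmulrn ler_nat; lia.
lra.
Qed.

Lemma nearest_projE e y x :
  nearest_proj (range e) y x <-> exists2 m, nearest e y m & x = e m.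
Proof.
split=> [[[m _ <-] E]|[m near ->]].
  exists m => // n; rewrite -lee_fin E; apply: ereal_inf_lbound.
  by exists (e n) => //; exists n.
split; first by exists m.
apply/eqP; rewrite eq_le; apply/andP; split.
  apply: le_ereal_inf_tmp => _ [_ [n _ <-] <-].
  by rewrite lee_fin.
by apply: ereal_inf_lbound; exists (e m) => //; exists m.
Qed.

(** Unfolds the extended-real infima and suprema of the definition. *)
Lemma contracting_rangeP C e :
  C_contracting_set C (range e) <->
  forall I gamma, geodesic_on I gamma ->
    (forall s n, I s -> C <= mdist (gamma s) (e n)) ->
    forall s t m n, I s -> I t -> nearest e (gamma s) m ->
      nearest e (gamma t) n -> mdist (e m) (e n) <= C.
Proof.
split=> H I gamma geo far.
  move=> s t m n Is It nm nn.
  have /(H I gamma geo) : (C%:E <= dist_set (gamma @` I) (range e))%E.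
    apply: le_ereal_inf_tmp => _ [_ [u Iu <-] <-].
    apply: le_ereal_inf_tmp => _ [_ [k _ <-] <-].
    by rewrite lee_fin; exact: far.
  rewrite -lee_fin; apply: le_trans.
  apply: ereal_sup_ubound; exists (e m, e n) => //; split => /=.
    by exists (gamma s); [exists s|apply/nearest_projE; exists m].
  by exists (gamma t); [exists t|apply/nearest_projE; exists n].
apply: ge_ereal_sup => _ [[p q] [/= Pp Pq] <-].
case: Pp => _ [s Is <-] /nearest_projE[m nm ->].
case: Pq => _ [t It <-] /nearest_projE[n nn ->].
rewrite lee_fin; apply: (H I gamma geo) nm nn => // u k Iu.
rewrite -lee_fin; apply: (le_trans far).
apply: (@le_trans _ _ (dist_pt_set (gamma u) (range e))).
  by apply: ereal_inf_lbound; exists (gamma u) => //; exists u.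
by apply: ereal_inf_lbound; exists (e k) => //; exists k.
Qed.

Lemma geodesic_on_sub (I : set R) (gamma : R -> Y) a b :
  geodesic_on I gamma -> a <= b -> (forall s, a <= s <= b -> I s) ->
  geodesic_on [set` `[a, b]] gamma.
Proof.
move=> [_ _ geo] ab sub; split.
- move=> u v; rewrite /= !in_itv /= => /andP[au ub] /andP[av vb] w /andP[uw wv].
  by rewrite in_itv /= (le_trans au) //= (le_trans wv).
- by exists a; rewrite /= in_itv /= lexx.
- by move=> u v; rewrite /= !in_itv /= => Iu Iv; apply: geo; apply: sub.
Qed.

(** The entry time is the infimum of the times at which the geodesic is within
[C] of the sequence.  Before it the geodesic stays [C]-far, hence the projection
of its origin and the projection of the entry point are [C]-close, and the entry
point itself is at distance at most [C + 1] from the sequence. *)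
Lemma entry_point C e (gamma : R -> Y) l m :
  0 <= C -> spread e -> C_contracting_set C (range e) ->
  0 <= l -> geodesic_on [set` `[0, l]] gamma -> nearest e (gamma 0) m ->
  (forall s n, 0 <= s <= l -> C <= mdist (gamma s) (e n)) \/
  exists s0, [/\ 0 <= s0 <= l, mdist (e m) (gamma s0) <= 2 * C + 1 &
    forall s n, 0 <= s < s0 -> C <= mdist (gamma s) (e n)].
Proof.
move=> C0 spr /contracting_rangeP ctr l0 geo nm.
have dg s t : 0 <= s <= l -> 0 <= t <= l -> mdist (gamma s) (gamma t) = `|s - t|.
  by case: geo => _ _ H sl tl; apply: H; rewrite /= in_itv.
pose E := [set s | 0 <= s <= l /\ exists n, mdist (gamma s) (e n) < C].
have [[s1 Es1]|nE] := pselect (exists s, E s); last first.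
  left=> s n sl; rewrite leNgt; apply/negP => lt; apply: nE; exists s.
  by split => //; exists n.
right; have hE : has_inf E.
  by split; [exists s1|exists 0 => s [/andP[]]].
have inf_le s : E s -> inf E <= s by move=> Es; apply: (ge_inf hE.2).
have s0l : 0 <= inf E <= l.
  rewrite lb_le_inf; [|by exists s1|by move=> s [/andP[]]].
  by apply: le_trans (inf_le _ Es1) _; case: Es1 => /andP[].
have far s n : 0 <= s < inf E -> C <= mdist (gamma s) (e n).
  move=> /andP[s0 slt]; rewrite leNgt; apply/negP => lt.
  suff /inf_le : E s by rewrite leNgt slt.
  split; [move: (inf_le _ Es1); case: Es1 => /andP[]; lra|by exists n].
have [s2 [s2l [n2 lt2]] s2lt] := inf_adherent (@ltr01 R) hE.
have d2 : mdist (gamma (inf E)) (e n2) <= C + 1.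
  have := metric_triangle (gamma (inf E)) (gamma s2) (e n2).
  rewrite dg // => tri.
  have : inf E <= s2 by apply: inf_le; split => //; exists n2.
  move: (normP (inf E - s2)) => [[]|[]]; lra.
exists (inf E); split => //.
have [E0|E0] := eqVneq (inf E) 0.
  rewrite E0 metric_sym; rewrite E0 in d2; have := nm n2; lra.
have Epos : 0 < inf E by rewrite lt_neqAle eq_sym E0; case/andP: s0l.
have [k nk] := nearest_exists spr (gamma (inf E)).
have far' s n : 0 <= s <= inf E -> C <= mdist (gamma s) (e n).
  move=> /andP[s0]; rewrite le_eqVlt => /orP[/eqP ->|lt]; last by apply: far; rewrite s0.
  rewrite leNgt; apply/negP => lt.
  (* a time [dl] before the entry, the geodesic would still be [C]-close *)
  pose dl := Num.min (inf E) ((C - mdist (gamma (inf E)) (e n)) / 2).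
  have dl0 : 0 < dl by rewrite lt_min Epos /=; lra.
  have dl1 : dl <= inf E by rewrite ge_min lexx.
  have dl2 : dl <= (C - mdist (gamma (inf E)) (e n)) / 2 by rewrite ge_min lexx orbT.
  have sl : 0 <= inf E - dl <= l by lra.
  have := metric_triangle (gamma (inf E - dl)) (gamma (inf E)) (e n).
  rewrite dg // (_ : inf E - dl - inf E = - dl) ?normrN ?gtr0_norm //; last by ring.
  have : C <= mdist (gamma (inf E - dl)) (e n) by apply: far; lra.
  lra.
have geo' : geodesic_on [set` `[0, inf E]] gamma.
  apply: geodesic_on_sub geo (ltW Epos) _ => s sl.
  by rewrite /= in_itv /=; lra.
have dk : mdist (e m) (e k) <= C.
  apply: (ctr _ _ geo') nm nk => [s n||]; rewrite /= in_itv /=; last 2 first.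
  - by rewrite lexx ltW.
  - by rewrite lexx ltW.
  exact: far'.
have := metric_triangle (e m) (e k) (gamma (inf E)).
by have := nk n2; rewrite (metric_sym (e k)); lra.
Qed.

(** Cut a geodesic at its first entry into and its last exit from the
[C]-neighbourhood of the sequence; the two cutting points are within [2 * C + 1]
of the two projections. *)
Lemma contracting_projection_ineq C e :
  geodesic_space Y -> 1 <= C -> spread e -> C_contracting_set C (range e) ->
  projection_ineq (8 * C + 4) e.
Proof.
move=> geoY C1 spr ctr x y m n nm nn big.
have C0 : 0 <= C by lra.
have [gamma [geo g0 gl]] := geoY x y; set l := mdist x y in geo gl *.
have l0 : 0 <= l by exact: mdist_ge0.
have dg s t : 0 <= s <= l -> 0 <= t <= l -> mdist (gamma s) (gamma t) = `|s - t|.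
  by case: geo => _ _ H sl tl; apply: H; rewrite /= in_itv.
(* the last exit is the first entry of the reversed geodesic *)
pose gamma' s := gamma (l - s).
have geo' : geodesic_on [set` `[0, l]] gamma'.
  case: geo => I1 I2 _; split => // s t; rewrite /= !in_itv /= => sl tl.
  by rewrite /gamma' dg; [|lra|lra]; rewrite distrC; congr (`| _ |); ring.
have nofar : ~ (forall s k, 0 <= s <= l -> C <= mdist (gamma s) (e k)).
  move=> far; suff : mdist (e m) (e n) <= C by lra.
  move/contracting_rangeP : ctr => /(_ _ _ geo) ctr.
  apply: (ctr _ 0 l).
  - by move=> s k; rewrite /= in_itv => /= sl; exact: far.
  - by rewrite /= in_itv /= lexx.
  - by rewrite /= in_itv /= l0 lexx.
  - by rewrite g0.
  - by rewrite gl.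
have nm0 : nearest e (gamma 0) m by rewrite g0.
have nn0 : nearest e (gamma' 0) n by rewrite /gamma' subr0 gl.
case: (entry_point C0 spr ctr l0 geo nm0) => [/nofar//|[s0 [s0l ms0 far0]]].
case: (entry_point C0 spr ctr l0 geo' nn0) => [far1|[s1 [s1l ns1 far1]]].
  case: nofar => s k sl; have := far1 (l - s) k; rewrite /gamma' subKr; apply; lra.
have s01 : s0 <= l - s1.
  rewrite leNgt; apply/negP => lt; apply: nofar => s k /andP[sl0 sl1].
  have [lt0|ge0] := ltP s s0; first by apply: far0; rewrite sl0.
  have := far1 (l - s) k; rewrite /gamma' subKr; apply; lra.
have := dg 0 s0; have := dg s0 (l - s1); have := dg (l - s1) l.
rewrite g0 gl !ler0_norm; try lra.
move=> d1 d2 d3.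
have := metric_triangle x (gamma s0) (e m); rewrite (metric_sym (gamma s0)).
have := metric_triangle (e m) (gamma s0) (e n).
have := metric_triangle (gamma s0) (gamma (l - s1)) (e n).
rewrite (metric_sym (gamma (l - s1)) (e n)).
have := metric_triangle (e n) (gamma (l - s1)) y.
rewrite /gamma' in ns1; lra.
Qed.

Lemma discrete_crossing (Q : nat -> Prop) M :
  Q 0%N -> ~ Q M -> exists i, Q i /\ ~ Q i.+1.
Proof.
elim: M => [//|M IH] Q0 QM.
by have [QM'|QM'] := pselect (Q M); [exists M|exact: IH].
Qed.

(** Suppose that two points of a geodesic far from the sequence have projections
more than [3 * K + 1] apart.  The projection moves by at most [K] in unit time,
since a larger jump would take twice the distance to the sequence; hence some
intermediate point [gamma v] projects further than [K] from both.  The projection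
inequality then makes the geodesic come near the sequence at [gamma v]. *)
Lemma projection_ineq_contracting K e :
  0 <= K -> spread e -> projection_ineq K e -> contracting_set (range e).
Proof.
move=> K0 spr pri; exists (3 * K + 1); split; first by lra.
apply/contracting_rangeP => I gamma [intI _ geo] far.
have [P HP] := choice (nearest_exists spr).
have same s m n : I s -> nearest e (gamma s) m -> nearest e (gamma s) n ->
    mdist (e m) (e n) <= K.
  move=> Is nm nn; rewrite leNgt; apply/negP => /(pri _ _ _ _ nm nn).
  have := far s m Is; have := mdist_ge0 (e m) (e n).
  by have := mdist_ge0 (e n) (gamma s); rewrite mdistxx; lra.
suff main s t m n : s <= t -> I s -> I t -> nearest e (gamma s) m ->
    nearest e (gamma t) n -> mdist (e m) (e n) <= 3 * K + 1.
  move=> s t m n Is It nm nn; have [st|/ltW ts] := leP s t; first exact: main nm nn.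
  by rewrite metric_sym; exact: main nn nm.
move=> st Is It nm nn; rewrite leNgt; apply/negP => big.
pose u (i : nat) := Num.min (s + i%:R) t.
have u_ge i : s <= u i by rewrite le_min st lerDl ler0n.
have u_le i : u i <= t by rewrite ge_min lexx orbT.
have Iu i : I (u i) by apply: intI Is It _ _; rewrite u_ge u_le.
have [M HM] := exists_nat_gt (t - s).
have uM : u M = t by apply/min_idPr; lra.
have u0 : u 0%N = s by rewrite /u addr0; apply/min_idPl.
pose Q i : Prop := mdist (e m) (e (P (gamma (u i)))) <= K.
have Q0 : Q 0%N by rewrite /Q u0; exact: same nm (HP _).
have QM : ~ Q M.
  rewrite /Q uM => QM; have := same _ _ _ It nn (HP _).
  have := metric_triangle (e m) (e (P (gamma t))) (e n).
  by rewrite (metric_sym (e (P _))); lra.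
have [i [Qi Qi1]] := @discrete_crossing Q M Q0 QM.
have step : u i <= u i.+1 <= u i + 1.
  rewrite /u -natr1 addrA; set a := s + i%:R.
  by case: (leP a t) => ?; case: (leP (a + 1) t) => ?; lra.
set v := u i.+1 in Qi1 step; set r := P (gamma v) in Qi1.
have nr : nearest e (gamma v) r := HP _.
have Iv : I v := Iu i.+1.
have [sv vt] : s <= v /\ v <= t by split; [exact: u_ge|exact: u_le].
have d1 : mdist (e (P (gamma (u i)))) (e r) <= K.
  rewrite leNgt; apply/negP => /(pri _ _ _ _ (HP _) nr).
  rewrite (geo _ v (Iu i) Iv) (metric_sym _ (gamma v)).
  rewrite ler0_norm; last by lra.
  have := far _ (P (gamma (u i))) (Iu i); have := far _ r Iv.
  have := mdist_ge0 (e (P (gamma (u i)))) (e r); lra.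
have d2 := metric_triangle (e m) (e (P (gamma (u i)))) (e r).
have d3 := metric_triangle (e m) (e r) (e n).
have b1 : K < mdist (e m) (e r) by rewrite ltNge; apply/negP.
have b2 : K < mdist (e r) (e n) by move: Qi; rewrite /Q; lra.
have := pri _ _ _ _ nm nr b1; have := pri _ _ _ _ nr nn b2.
rewrite (geo s v Is Iv) (geo v t Iv It) !ler0_norm ?subr_le0 //.
have := far _ r Iv; rewrite (metric_sym (e r) (gamma v)).
have := metric_triangle (gamma s) (e m) (gamma t).
have := metric_triangle (e m) (e n) (gamma t).
rewrite (geo _ _ Is It) ler0_norm ?subr_le0 //; lra.
Qed.

End Contraction.

(** * Integer powers *)

Section IntegerPowers.
Context {G : groupType}.
Implicit Types (g h t : G).

Lemma zpow0 h : zpow h 0 = 1%g. Proof. by []. Qed.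

Lemma zpow1 h : zpow h 1 = h. Proof. by []. Qed.

Lemma zpow_nat h (n : nat) : zpow h n = (h ^+ n)%g. Proof. by []. Qed.

Lemma zpow_natN h (n : nat) : zpow h (- n%:Z) = (h ^- n)%g.
Proof. by case: n => [|n]; rewrite ?oppr0 /= ?expg0 ?invg1. Qed.

Lemma zpowS h n : zpow h (n + 1) = (zpow h n * h)%g.
Proof.
case: n => n; first by rewrite -PoszD addn1 /= expgSr.
have -> : Negz n + 1 = - n%:Z by rewrite NegzE; lia.
by rewrite zpow_natN /= expgS invgM mulgVK.
Qed.

Lemma zpowB1 h n : zpow h (n - 1) = (zpow h n * h^-1)%g.
Proof. by rewrite -{2}(subrK 1 n) zpowS mulgK. Qed.

Lemma zpowD h m n : zpow h (m + n) = (zpow h m * zpow h n)%g.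
Proof.
elim: n => [|n IH|n IH]; first by rewrite addr0 zpow0 mulg1.
- by rewrite -addn1 PoszD addrA !zpowS IH mulgA.
- by rewrite -addn1 PoszD opprD addrA !zpowB1 IH mulgA.
Qed.

Lemma zpowN h n : zpow h (- n) = (zpow h n)^-1%g.
Proof. by apply/esym/mulg1_eq; rewrite -zpowD subrr. Qed.

Lemma zpowM h (m n : int) : zpow h (m * n) = zpow (zpow h m) n.
Proof.
elim: n => [|n IH|n IH]; first by rewrite mulr0.
- by rewrite -addn1 PoszD mulrDr mulr1 zpowS zpowD IH.
- by rewrite -addn1 PoszD opprD mulrBr mulr1 zpowB1 zpowD IH (zpowN h m).
Qed.

Lemma zpow_conj t h n : zpow (t * h * t^-1)%g n = (t * zpow h n * t^-1)%g.
Proof.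
elim: n => [|n IH|n IH]; first by rewrite !zpow0 mulg1 mulgV.
- by rewrite -addn1 PoszD !zpowS IH -!mulgA mulKg.
- by rewrite -addn1 PoszD opprD !zpowB1 IH !invgM invgK -!mulgA mulKg.
Qed.

End IntegerPowers.

(** Fekete's argument: [tau] is the supremum of the slopes of the superadditive
sequence [x - K], and it lies below every slope of the subadditive sequence
[x]. *)
Lemma subadditive_slope (R : realType) (x : nat -> R) K :
  (forall a b, x (a + b)%N <= x a + x b) ->
  (forall a b, x a + x b <= x (a + b)%N + K) ->
  exists tau, forall n, tau * n%:R <= x n <= tau * n%:R + K.
Proof.
move=> sub sup.
have x0 : 0 <= x 0%N by have := sub 0%N 0%N; rewrite addn0; lra.
have xM m n : x (n.+1 * m)%N <= x m * n.+1%:R.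
  elim: n => [|n IH]; first by rewrite mul1n mulr1.
  by rewrite mulSn -[in leRHS]natr1; have := sub m (n.+1 * m)%N; lra.
have Mx m n : (x m - K) * n.+1%:R <= x (n.+1 * m)%N - K.
  elim: n => [|n IH]; first by rewrite mul1n mulr1.
  by rewrite mulSn -[in leLHS]natr1; have := sup m (n.+1 * m)%N; lra.
pose S := [set (x n.+1 - K) / n.+1%:R | n in [set: nat]].
have ubS m : ubound S (x m.+1 / m.+1%:R).
  move=> _ [n _ <-].
  rewrite ler_pdivrMr ?ltr0Sn // mulrAC ler_pdivlMr ?ltr0Sn //.
  apply: le_trans (Mx n.+1 m) _; apply: le_trans (xM m.+1 n).
  by rewrite mulnC; have := sup 0%N 0%N; rewrite addn0; lra.
have supS : has_sup S by split; [exists ((x 1%N - K) / 1%:R); exists 0%N|exists (x 1%N / 1%:R); exact: (ubS 0%N)].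
exists (reals.sup S) => -[|n].
  by rewrite mulr0 add0r x0 /=; have := sup 0%N 0%N; rewrite addn0; lra.
rewrite -ler_pdivlMr ?ltr0Sn // ge_sup /=; [|exact: supS.1|exact: ubS].
rewrite -lerBlDr -ler_pdivrMr ?ltr0Sn //.
by apply: ub_le_sup; [exact: supS.2|exists n].
Qed.

(** * Coordinates with respect to the axis of a contracting element *)

Section Action.
Context {R : realType} {Y : metricType R} {G : groupType}.
Context (act : G -> Y -> Y) (o : Y).
Hypothesis isom : isometric_action act.

Lemma act1 y : act 1%g y = y. Proof. by case: isom. Qed.

Lemma actM g h y : act (g * h)%g y = act g (act h y).
Proof. by case: isom. Qed.

Lemma act_mdist g x y : mdist (act g x) (act g y) = mdist x y.
Proof. by case: isom. Qed.

Lemma actK g : cancel (act g) (act g^-1%g).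
Proof. by move=> y; rewrite -actM mulVg act1. Qed.

Lemma actKV g : cancel (act g^-1%g) (act g).
Proof. by move=> y; rewrite -actM mulgV act1. Qed.

Lemma act_mdistV g x y : mdist (act g^-1%g x) y = mdist x (act g y).
Proof. by rewrite -(act_mdist g) actKV. Qed.

Definition orbit_point h (n : int) : Y := act (zpow h n) o.

Local Notation orb := orbit_point.

Lemma cyclic_orbitE h : [set act g o | g in cyclic_subgroup h] = range (orb h).
Proof.
apply/seteqP; split=> [_ [_ [n _ <-] <-]|_ [n _ <-]]; first by exists n.
by exists (zpow h n) => //; exists n.
Qed.

Lemma orb0 h : orb h 0 = o. Proof. exact: act1. Qed.

Lemma act_orb h m n : act (zpow h m) (orb h n) = orb h (m + n).
Proof. by rewrite /orbit_point -actM -zpowD. Qed.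

Lemma orb_mdist h m n k : mdist (orb h (k + m)) (orb h (k + n)) = mdist (orb h m) (orb h n).
Proof. by rewrite -!act_orb act_mdist. Qed.

Lemma orb_mdist0 h m n : mdist (orb h m) (orb h n) = mdist o (orb h (n - m)).
Proof. by rewrite -{1}(orb0 h) -(orb_mdist h 0 _ m) addr0 subrKC. Qed.

Lemma orb_abs h (n : int) : mdist o (orb h n) = mdist o (orb h `|n|).
Proof.
case: (ger0P n) => // _.
by rewrite -{2}(orb0 h) -(orb_mdist h 0 (- n) n) subrr addr0 orb0 metric_sym.
Qed.

(** Up to the error [K], the space looks from the orbit of [h] like a line with
hairs: [rho y] is the coordinate on the line (the nearest index scaled by the
translation length [tau]) and [ht y] is the length of the hair.  Estimate
[axis_ge] is the projection inequality. *)
Record axis_coordinates h (tau K : R) (rho ht : Y -> R) : Prop := AxisCoordinates {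
  axis_tau : 0 < tau;
  axis_K : 1 <= K;
  axis_ht : forall y, 0 <= ht y;
  axis_foot : forall y, exists n : int,
    rho y = tau * n%:~R /\ mdist y (orb h n) = ht y;
  axis_orbit_le : forall y n,
    mdist y (orb h n) <= ht y + `|rho y - tau * n%:~R| + K;
  axis_orbit_ge : forall y n,
    ht y + `|rho y - tau * n%:~R| <= mdist y (orb h n) + K;
  axis_le : forall x y, mdist x y <= ht x + `|rho x - rho y| + ht y + K;
  axis_ge : forall x y, K < `|rho x - rho y| ->
    ht x + `|rho x - rho y| + ht y <= mdist x y + K;
  axis_shift : forall y n,
    `|rho (act (zpow h n) y) - rho y - tau * n%:~R| <= K }.

Lemma orb_lipschitz h m n :
  mdist (orb h m) (orb h n) <= mdist o (act h o) * `|m - n|%:~R.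
Proof.
suff pos (k : nat) : mdist o (orb h k) <= mdist o (act h o) * k%:R.
  by rewrite orb_mdist0 orb_abs distrC -abszE -pmulrn.
elim: k => [|k IH]; first by rewrite orb0 mdistxx mulr0.
have := metric_triangle o (orb h k) (orb h k.+1).
rewrite -addn1 PoszD (orb_mdist0 h k) [_ + 1]addrC addrK /orbit_point zpow1 natrD /= mulrDr mulr1.
by move: IH; rewrite /orbit_point /=; lra.
Qed.

Lemma int_dist_between (p q a : int) : p <= a <= q -> `|a - p| <= `|p - q| /\ `|a - q| <= `|p - q|.
Proof. lia. Qed.

Lemma min_succ_dist (T : realDomainType) (l : T) (i : nat) :
  `|Num.min i%:R l - Num.min i.+1%:R l| <= 1.
Proof.
rewrite -natr1.
by case: (leP (i%:R : T) l) => ?; case: (leP (i%:R + 1 : T) l) => ?; norm_cases; lra.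
Qed.

(** The point [orb h a] lies near any geodesic from [o] to [orb h (a + b)]: points
of the geodesic are [2 * K]-close to the orbit by the projection inequality, and
their projections move from index 0 to index [a + b] by bounded steps, hence pass
near index [a]. *)
Lemma orbit_coarsely_additive h K : geodesic_space Y ->
  spread (orb h) -> 0 <= K -> projection_ineq K (orb h) ->
  exists D, forall a b : nat,
    mdist o (orb h a) + mdist o (orb h b) <= mdist o (orb h (a + b)%N) + D.
Proof.
move=> geoY spr K0 pri; have [P HP] := choice (nearest_exists spr).
have [lam [c [lam0 spr0]]] := spr.
pose La := mdist o (act h o); have La0 : 0 <= La by exact: mdist_ge0.
have c0 : 0 <= c by have := spr0 0 0; rewrite subrr normr0 mulr0 mdistxx; lra.
pose D := La * ((1 + 4 * K + c) / lam) + 2 * K.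
have La_mono M1 M2 : M1 <= M2 -> La * ((M1 + c) / lam) <= La * ((M2 + c) / lam).
  by move=> le; rewrite ler_wpM2l // ler_pM2r ?invr_gt0 //; lra.
exists (2 * D + 2 * (La * ((2 * K + c) / lam))) => a b.
have D20 : 0 <= La * ((2 * K + c) / lam).
  by rewrite mulr_ge0 // divr_ge0 //; lra.
have D0 : 0 <= D.
  by apply: addr_ge0; [rewrite mulr_ge0 // divr_ge0 //|]; lra.
set n := (a + b)%N; set l := mdist o (orb h n).
(* the projection inequality says nothing on short segments, but then [a] and
   [b] are bounded *)
have [lsmall|lbig] := leP l (2 * K).
  have small k : (k <= n)%N -> mdist o (orb h k) <= La * ((2 * K + c) / lam).
    move=> kn; rewrite -(orb0 h); apply: le_trans (orb_lipschitz _ _ _) _.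
    rewrite ler_wpM2l // ler_pdivlMr // mulrC.
    have := spr0 0 n; rewrite orb0 -/l.
    have : lam * `|0 - k%:Z|%:~R <= lam * `|0 - n%:Z|%:~R.
      by rewrite ler_pM2l // ler_int !sub0r !normrN /=; lia.
    lra.
  have := small a (leq_addr _ _); have := small b (leq_addl _ _).
  have : 0 <= l by exact: mdist_ge0.
  lra.
have xb : mdist o (orb h b) = mdist (orb h a) (orb h n).
  by rewrite orb_mdist0 /n PoszD addrAC subrr add0r.
suff [y [day ly]] : exists y, mdist (orb h a) y <= D /\ mdist o y + mdist y (orb h n) = l.
  rewrite xb; have := metric_triangle o y (orb h a).
  have := metric_triangle (orb h a) y (orb h n).
  by rewrite (metric_sym y (orb h a)); lra.
have [gamma [[_ _ geo] g0 gl]] := geoY o (orb h n); rewrite -/l in geo gl.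
have l0 : 0 <= l by lra.
have dg s t : 0 <= s <= l -> 0 <= t <= l -> mdist (gamma s) (gamma t) = `|s - t|.
  by move=> sl tl; apply: geo; rewrite /= in_itv.
pose u (i : nat) := Num.min i%:R l.
have ul i : 0 <= u i <= l by rewrite le_min ler0n l0 ge_min lexx orbT.
have split s : 0 <= s <= l -> mdist o (gamma s) + mdist (gamma s) (orb h n) = l.
  move=> sl; rewrite -g0 -gl !dg ?lexx ?l0 // !ler0_norm; lra.
suff [i Di] : exists i, mdist (orb h a) (gamma (u i)) <= D.
  by exists (gamma (u i)); split => //; exact: split.
have [M HM] := exists_nat_gt l.
have near0 : nearest (orb h) o 0 by move=> k; rewrite orb0 mdistxx; exact: mdist_ge0.
have nearn : nearest (orb h) (orb h n) n by move=> k; rewrite mdistxx; exact: mdist_ge0.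
have u0 : u 0%N = 0 by apply/min_idPl.
have uM : u M = l by apply/min_idPr; lra.
have Z0 : mdist o (orb h (P (gamma 0))) <= 0.
  by have := HP (gamma 0) 0; rewrite g0 orb0 mdistxx.
have Zn : mdist (orb h n) (orb h (P (gamma l))) <= 0.
  by have := HP (gamma l) n; rewrite gl mdistxx.
have La_le M1 : 0 <= M1 <= 1 + 4 * K -> La * ((M1 + c) / lam) <= D - 2 * K.
  by move=> M1le; rewrite /D addrK; apply: La_mono; lra.
have foot s : 0 <= s <= l -> mdist (gamma s) (orb h (P (gamma s))) <= 2 * K.
  move=> sl; have nz := HP (gamma s); set r := P (gamma s) in nz *.
  have := split s sl; have := metric_triangle o (orb h r) (orb h n); rewrite -/l.
  have := mdist_ge0 o (gamma s); have := mdist_ge0 (gamma s) (orb h n).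
  have := pri _ _ _ _ near0 nz; have := pri _ _ _ _ nz nearn.
  rewrite orb0 !mdistxx (metric_sym (orb h r) (gamma s)).
  have [big1|small1] := ltP K (mdist (orb h r) (orb h n)).
    move=> /(_ isT) H1; have [big2 /(_ isT)|small2 _] := ltP K (mdist o (orb h r)); lra.
  by move=> _; have [big2 /(_ isT)|small2 _] := ltP K (mdist o (orb h r)); lra.
pose Q i : Prop := P (gamma (u i)) < a.
have [Q0|/negP nQ] := boolP (P (gamma 0) < a); last first.
  exists 0%N; rewrite u0 g0 -(orb0 h).
  have a0 : 0 <= a%:Z <= P (gamma 0) by rewrite /= leNgt; apply/negP.
  apply: le_trans (orb_lipschitz _ _ _) _; rewrite -/La.
  apply: (@le_trans _ _ (La * ((0 + c) / lam))); last by apply: le_trans (La_le 0 _) _; lra.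
  rewrite ler_wpM2l // ler_pdivlMr // mulrC add0r.
  have := spr0 0 (P (gamma 0)); rewrite orb0.
  have : lam * `|a%:Z - 0|%:~R <= lam * `|0 - P (gamma 0)|%:~R.
    by rewrite ler_pM2l // ler_int (int_dist_between a0).1.
  lra.
have [QM|/negP QM] := boolP (P (gamma l) < a).
  exists M; rewrite uM gl.
  apply: le_trans (orb_lipschitz _ _ _) _; rewrite -/La.
  apply: (@le_trans _ _ (La * ((0 + c) / lam))); last by apply: le_trans (La_le 0 _) _; lra.
  rewrite ler_wpM2l // ler_pdivlMr // mulrC add0r.
  have := spr0 n (P (gamma l)).
  have : lam * `|a%:Z - n%:Z|%:~R <= lam * `|n%:Z - P (gamma l)|%:~R.
    rewrite ler_pM2l // ler_int [leRHS]distrC; apply: (int_dist_between _).2.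
    by rewrite (ltW QM) lez_nat leq_addr.
  lra.
have [i [Qi Qi1]] : exists i, Q i /\ ~ Q i.+1.
  by apply: (@discrete_crossing Q M); rewrite /Q ?u0 ?uM.
exists i.
have step : mdist (gamma (u i)) (gamma (u i.+1)) <= 1.
  by rewrite dg //; exact: min_succ_dist.
rewrite /Q in Qi Qi1.
have f1 := foot _ (ul i); have f2 := foot _ (ul i.+1).
set p := P (gamma (u i)) in Qi f1; set q := P (gamma (u i.+1)) in Qi1 f2.
have dpq : mdist (orb h p) (orb h q) <= 1 + 4 * K.
  have := metric_triangle (orb h p) (gamma (u i)) (orb h q).
  have := metric_triangle (gamma (u i)) (gamma (u i.+1)) (orb h q).
  by rewrite (metric_sym (orb h p) (gamma (u i))); lra.
have dap : mdist (orb h a) (orb h p) <= D - 2 * K.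
  apply: le_trans (orb_lipschitz _ _ _) _; rewrite -/La /D addrK.
  rewrite ler_wpM2l // ler_pdivlMr // mulrC.
  have := spr0 p q.
  have : lam * `|a%:Z - p|%:~R <= lam * `|p - q|%:~R.
    rewrite ler_pM2l // ler_int (int_dist_between _).1 //.
    by rewrite (ltW Qi) /= leNgt; apply/negP.
  lra.
have := metric_triangle (orb h a) (orb h p) (gamma (u i)).
by rewrite (metric_sym (orb h p) (gamma _)); lra.
Qed.

(** By [subadditive_slope] the distance of [orb h m] and [orb h n] is
[tau * |m - n|] up to a constant, so the projection inequality can be read in the
coordinates. *)
Lemma contracting_coordinates h : geodesic_space Y ->
  contracting_element act o h -> exists tau K rho ht, axis_coordinates h tau K rho ht.
Proof.
move=> geoY [ctr [lam' [c [lam1 c0 qi]]]].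
pose lam := lam'^-1; have lam0 : 0 < lam by rewrite invr_gt0; lra.
rewrite cyclic_orbitE in ctr.
have spr0 (m n : int) : lam * `|m - n|%:~R - c <= mdist (orb h m) (orb h n).
  by have /andP[] := qi m n.
have spr : spread (orb h) by exists lam, c.
case: ctr => C [C1 ctr].
have [K0 [K00 pri]] : exists K, 0 <= K /\ projection_ineq K (orb h).
  by exists (8 * C + 4); split; [lra|exact: contracting_projection_ineq].
have [P HP] := choice (nearest_exists spr).
have [D HD] := orbit_coarsely_additive geoY spr K00 pri.
have [||tau Htau] := @subadditive_slope R (fun n : nat => mdist o (orb h n)) D.
- move=> a b; rewrite PoszD; apply: le_trans (metric_triangle o (orb h a) _) _.
  by rewrite -act_orb /orbit_point act_mdist.
- exact: HD.
have D0 : 0 <= D by have := Htau 0%N; lra.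
have lin (m n : int) : tau * `|m - n|%:~R <= mdist (orb h m) (orb h n) <= tau * `|m - n|%:~R + D.
  by rewrite orb_mdist0 orb_abs (distrC m n) -abszE -pmulrn.
have tau0 : 0 < tau.
  have [n Hn] := exists_nat_gt ((c + D) / lam).
  have := lin 0 n; have := spr0 0 n; rewrite sub0r normrN /=.
  rewrite -[(n%:~R : R)]/(n%:R).
  rewrite ltr_pdivrMr // mulrC in Hn => h1 h2.
  have n0 : 0 < (n%:R : R).
    by rewrite ltr0n lt0n; apply/eqP => n0; move: Hn; rewrite n0 mulr0; lra.
  rewrite -(pmulr_lgt0 _ n0); lra.
exists tau, (2 * K0 + 2 * D + 1), (fun y => tau * (P y)%:~R), (fun y => mdist y (orb h (P y))).
have absE (m n : int) : `|tau * m%:~R - tau * n%:~R| = tau * `|m - n|%:~R.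
  by rewrite -mulrBr normrM gtr0_norm // -intrB intr_norm.
have near_refl n : nearest (orb h) (orb h n) n by move=> k; rewrite mdistxx; exact: mdist_ge0.
have pri' y n : mdist y (orb h (P y)) + mdist (orb h (P y)) (orb h n) <= mdist y (orb h n) + K0.
  have [big|small] := ltP K0 (mdist (orb h (P y)) (orb h n)).
    by have := pri _ _ _ _ (HP y) (near_refl n) big; rewrite mdistxx; lra.
  by have := HP y n; lra.
split => //.
- lra.
- by move=> y; exact: mdist_ge0.
- by move=> y; exists (P y).
- move=> y n; rewrite absE; have := metric_triangle y (orb h (P y)) (orb h n).
  have := lin (P y) n; lra.
- move=> y n; rewrite absE; have := pri' y n; have := lin (P y) n; lra.
- move=> x y; rewrite absE; have := lin (P x) (P y).
  have := metric_triangle x (orb h (P x)) y.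
  have := metric_triangle (orb h (P x)) (orb h (P y)) y.
  rewrite (metric_sym (orb h (P y)) y); lra.
- move=> x y; rewrite absE => big; have := lin (P x) (P y) => linxy.
  have /(pri _ _ _ _ (HP x) (HP y)) : K0 < mdist (orb h (P x)) (orb h (P y)) by lra.
  rewrite (metric_sym (orb h (P y)) y); lra.
- move=> y n; set y' := act _ y.
  have ny : nearest (orb h) y' (n + P y).
    move=> k; rewrite -(subrKC n k) -(act_orb h n (P y)) -(act_orb h n (k - n)) !act_mdist; exact: HP.
  rewrite -!mulrBr -!intrB normrM gtr0_norm // -intr_norm.
  rewrite -addrA -opprD (addrC (P y)).
  have := lin (P y') (n + P y); have := pri _ _ _ _ (HP y') ny; rewrite mdistxx.
  have := mdist_ge0 y' (orb h (P y')); have := mdist_ge0 (orb h (n + P y)) y'.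
  have [big ? ? /(_ isT)|small ? ? _] := ltP K0 (mdist (orb h (P y')) (orb h (n + P y))); lra.
Qed.

End Action.

(** * Links *)

Section Links.
Context {R : realType} {Y : metricType R} {G : groupType}.
Context (act : G -> Y -> Y) (o : Y).
Hypothesis isom : isometric_action act.
Context (f : G) (tau K : R) (rho ht : Y -> R).
Hypothesis ax : axis_coordinates act o f tau K rho ht.
Local Notation orb := (orbit_point act o).

Definition displacement g := mdist o (act g o).

Local Notation len := displacement.

Lemma len_ge0 g : 0 <= len g. Proof. exact: mdist_ge0. Qed.

Lemma lenV g : len g^-1%g = len g.
Proof. by rewrite /displacement metric_sym act_mdistV //. Qed.

Lemma lenM g h : len (g * h)%g <= len g + len h.
Proof.
by have := metric_triangle o (act g o) (act (g * h)%g o); rewrite /displacement actM // act_mdist //.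
Qed.

Lemma lenE g h : len (g^-1 * h)%g = mdist (act g o) (act h o).
Proof. by rewrite /displacement -(act_mdist isom g) -actM // mulVKg. Qed.

Lemma base_coordinate : ht o + `|rho o| <= K.
Proof.
by have := axis_orbit_ge ax o 0; rewrite orb0 // mdistxx mulr0 subr0 add0r.
Qed.

Lemma dist_base_le y : mdist y o <= ht y + `|rho y| + K.
Proof. by have := axis_orbit_le ax y 0; rewrite orb0 // mulr0 subr0. Qed.

Lemma dist_base_ge y : ht y + `|rho y| <= mdist y o + K.
Proof. by have := axis_orbit_ge ax y 0; rewrite orb0 // mulr0 subr0. Qed.

Variable N : nat.
Let l : R := tau * N%:R.
Let l0 : 0 <= l. Proof. by rewrite mulr_ge0 // ltW // (axis_tau ax). Qed.
Local Notation r := (orb f N).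

Lemma dist_end_le y : mdist y r <= ht y + `|rho y - l| + K.
Proof. exact: axis_orbit_le ax y N. Qed.

Lemma dist_end_ge y : ht y + `|rho y - l| <= mdist y r + K.
Proof. exact: axis_orbit_ge ax y N. Qed.

Lemma len_pow_le : len (zpow f N) <= l + 2 * K.
Proof.
have := dist_end_le o; have := base_coordinate; rewrite /displacement -/(orb f N).
have := ler_normB (rho o) l; rewrite (ger0_norm l0); lra.
Qed.

(** If [x] projects before [o] and [y] after [orb f N], the axis segment is on the
way from [x] to [y].  In this section [20 * B < l] expresses that the segment from
[o] to [orb f N] is long compared with all the errors. *)
Lemma crossing B x y : K <= B -> 20 * B < l ->
  rho x <= 2 * B -> l - 2 * B <= rho y ->
  mdist x o + mdist o y <= mdist x y + 7 * B.
Proof.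
move=> KB Bl xB yB; have K1 := axis_K ax.
have := dist_base_le x; have := dist_base_le y; have := axis_ge ax (x := x) (y := y).
rewrite distrC (ger0_norm (_ : 0 <= rho y - rho x)); last by lra.
move=> /(_ ltac:(lra)); rewrite (ger0_norm (_ : 0 <= rho y)) ?(metric_sym o y); last by lra.
by have [[? ->]|[? ->]] := normP (rho x); lra.
Qed.

(** The axis and its translate by [b] see each other as two successive segments of
a geodesic would: up to [B], both ends of the translated segment project to the
axis beyond its end [r], and both ends of the axis segment project to the
translated axis before its origin.  The coordinate of [y] on the translate by [b] is
[rho (act b^-1 y)]. *)
Definition link B b : Prop :=
  [/\ l - B <= rho (act b o), l - B <= rho (act b r),
      rho (act b^-1%g o) <= B & rho (act b^-1%g r) <= B].

(** A Behrstock-type inequality.  If [y] projected far along the second axis, then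
a path from [y] to [o] would pass by [b o]; it would run from the projection of
[y], which is at most the middle of the first segment, to the end of this segment
and then back over all of it, which is too long. *)
Lemma link_forward B b y : K <= B -> 20 * B < l -> link B b ->
  rho y <= l / 2 -> rho (act b^-1%g y) <= 2 * B.
Proof.
move=> KB Bl [h1 _ h3 _] yl; have K1 := axis_K ax.
rewrite leNgt; apply/negP => big.
set y' := act _ y in big; set o' := act _ o in h3.
have A1 : ht y' + (rho y' - rho o') + ht o' <= mdist y o + K.
  rewrite -(act_mdist isom b^-1%g) -/y' -/o'.
  have := axis_ge ax (x := y') (y := o'); rewrite ger0_norm; last by lra.
  by apply; lra.
have A2 : mdist y (act b o) <= ht y' + rho y' + K.
  have := dist_base_le y'; rewrite act_mdistV // ger0_norm //; lra.
have A3 : mdist (act b o) o <= ht o' - rho o' + 2 * B + K.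
  have := dist_base_le o'; rewrite act_mdistV // (metric_sym o).
  have [[? ->]|[? ->]] := normP (rho o'); lra.
have B1 : ht y + (rho (act b o) - rho y) + ht (act b o) <= mdist y (act b o) + K.
  have := axis_ge ax (x := y) (y := act b o); rewrite distrC ger0_norm; last by lra.
  by apply; lra.
have B2 := dist_base_ge (act b o); rewrite ger0_norm in B2; last by lra.
have := dist_base_le y; have := axis_ht ax (act b o).
by have [[? ->]|[? ->]] := normP (rho y); lra.
Qed.

(** The mirror image of [link_forward], seen from the other ends of the two
segments. *)
Lemma link_backward B b y : K <= B -> 20 * B < l -> link B b ->
  l / 2 <= rho (act b^-1%g y) -> l - 2 * B <= rho y.
Proof.
move=> KB Bl [_ h2 _ h4] yl; have K1 := axis_K ax.
rewrite leNgt; apply/negP => big.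
set y' := act _ y in yl; set p := act _ r in h4.
have A1 : ht y + (rho (act b r) - rho y) + ht (act b r) <= mdist y (act b r) + K.
  have := axis_ge ax (x := y) (y := act b r); rewrite distrC ger0_norm; last by lra.
  by apply; lra.
have A2 : mdist y r <= ht y + (l - rho y) + K.
  have := dist_end_le y; rewrite distrC ger0_norm //; lra.
have A3 : mdist (act b r) r <= ht (act b r) + rho (act b r) - l + 2 * B + K.
  have := dist_end_le (act b r).
  have [[? ->]|[? ->]] := normP (rho (act b r) - l); lra.
have B1 : ht y' + (rho y' - rho p) + ht p <= mdist y r + K.
  rewrite -(act_mdist isom b^-1%g) -/y' -/p.
  have := axis_ge ax (x := y') (y := p); rewrite ger0_norm; last by lra.
  by apply; lra.
have B2 : ht p + (l - rho p) <= mdist (act b r) r + K.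
  have := dist_end_ge p; rewrite act_mdistV // (metric_sym r) distrC ger0_norm //; lra.
have := dist_end_le y'; rewrite act_mdistV //.
have [[? ->]|[? ->]] := normP (rho y' - l); have := axis_ht ax p; have := axis_ht ax (act b r); lra.
Qed.

Lemma base_coordinate_le : rho o <= K.
Proof.
by have := base_coordinate; have := axis_ht ax o; have := ler_norm (rho o); lra.
Qed.

(** * Conjugates of links are contracting *)

Section PeriodicChain.
Context (B : R) (k : G).
Hypotheses (KB : K <= B) (Bl : 20 * B < l) (lk : link B k).
Local Notation q n := (act (zpow k n) o).
Local Notation coord n y := (rho (act (zpow k (- n)) y)).

Let B1 : 1 <= B. Proof. exact: le_trans (axis_K ax) KB. Qed.

Lemma coord_shift (n m : int) y : coord n (act (zpow k m) y) = coord (n - m) y.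
Proof. by rewrite -actM // -zpowD opprB addrC. Qed.

Lemma coord_forward (n : int) y : coord n y <= l / 2 -> coord (n + 1) y <= 2 * B.
Proof.
by move/(link_forward KB Bl lk); rewrite -actM // -[k^-1%g]zpow1 zpow1 -[X in (X * _)%g](zpowN k 1) -zpowD -opprD addrC.
Qed.

Lemma coord_backward (n : int) y : l / 2 <= coord (n + 1) y -> l - 2 * B <= coord n y.
Proof.
by move=> le; apply: (link_backward KB Bl lk); rewrite -actM // -(zpowN k 1) -zpowD -opprD addrC.
Qed.

Lemma coord_forward_leq (n m : int) y : n <= m -> coord n y <= l / 2 -> coord m y <= l / 2.
Proof.
move=> nm; have -> : m = n + `|m - n|%N by lia.
elim: `|_|%N => [|i IH]; first by rewrite addr0.
by rewrite -[i.+1]addn1 PoszD addrA => /IH/coord_forward; have := B1; have := Bl; lra.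
Qed.

Lemma chain_left (n : nat) : coord n%:Z o <= 2 * B.
Proof.
elim: n => [|n IH]; last by rewrite -[n.+1]addn1 PoszD; apply: coord_forward; move: IH; have := B1; have := Bl; lra.
by rewrite oppr0 zpow0 act1 //; have := base_coordinate_le; have := B1; have := KB; lra.
Qed.

Lemma chain_right (n : nat) : l - 2 * B <= coord (- n.+1%:Z) o.
Proof.
elim: n => [|n IH]; last first.
  by apply: coord_backward; rewrite (_ : - n.+2%:Z + 1 = - n.+1%:Z); [move: IH; have := B1; have := Bl; lra|lia].
by case: lk => h1 _ _ _; rewrite opprK zpow1; have := B1; lra.
Qed.

Lemma chain_cross (n : int) x y : coord n x <= 2 * B -> l - 2 * B <= coord n y ->
  mdist x (q n) + mdist (q n) y <= mdist x y + 7 * B.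
Proof.
move=> /(crossing KB Bl) cr /cr.
rewrite (act_mdist isom) !zpowN (act_mdistV isom _ x o).
by rewrite (metric_sym o (act _ y)) (act_mdistV isom _ y o) (metric_sym y).
Qed.

(** Each segment of the chain adds its length to the displacement. *)
Lemma chain_growth (n : nat) : n%:R <= len (zpow k n).
Proof.
elim: n => [|n IH]; first exact: len_ge0.
have crs : len (zpow k n) + len k <= len (zpow k n.+1) + 7 * B.
  have := @chain_cross n o (q n.+1) (chain_left n); rewrite coord_shift.
  rewrite (_ : n%:Z - n.+1%:Z = - 1%:Z); last by lia.
  move=> /(_ (chain_right 0)); rewrite -[n.+1]addn1 PoszD zpowD actM // act_mdist //.
  by rewrite zpow1 -(actM isom) -[X in (_ * X)%g](zpow1 k) -zpowD.
have lk_ge : l - 2 * B <= len k.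
  case: lk => h1 _ _ _; have := dist_base_ge (act k o); have := axis_ht ax (act k o).
  rewrite metric_sym -/(len k); have := ler_norm (rho (act k o)).
  have := KB; have := B1; lra.
by move: IH; rewrite -natr1; have := Bl; have := B1; lra.
Qed.

Lemma chain_spread (m n : int) : `|m - n|%:~R <= mdist (q m) (q n).
Proof.
rewrite -[mdist _ _]/(mdist (orbit_point act o k m) (orbit_point act o k n)) orb_mdist0 // orb_abs // distrC -abszE.
exact: chain_growth.
Qed.

(** The set of indices whose axis sees [y] in its first half is upward closed by
[link_forward]; it is neither empty nor everything, because the distance from [y]
to [q n] would otherwise decrease for ever.  Its least element is [i - 1];
[link_forward] and [link_backward] lose one index each to improve a half of the
segment to an end. *)
Lemma chain_threshold y : exists i : int,
  (forall n, i <= n -> coord n y <= 2 * B) /\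
  (forall n, n <= i - 3 -> l - 2 * B <= coord n y).
Proof.
have [M HM] := exists_nat_gt (mdist y o + 7 * B).
have chs (m : int) : (M%:R : R) <= `|m|%:~R -> mdist y o + 7 * B < mdist o (q m).
  move=> le; have := chain_spread 0 m; rewrite sub0r normrN zpow0 act1 //; lra.
have [n1 n1l] : exists n1 : int, coord n1 y <= l / 2.
  apply: contrapT => none.
  have far : l - 2 * B <= coord M%:Z y.
    apply: coord_backward; rewrite leNgt; apply/negP => lt.
    by apply: none; exists (M%:Z + 1); exact: ltW.
  have := @chain_cross M%:Z o y (chain_left M) far.
  have := chs M%:Z (lexx _); have := mdist_ge0 (q M%:Z) y.
  by rewrite (metric_sym o y); lra.
have [n0 n0r] : exists n0 : int, ~ (coord n0 y <= l / 2).
  apply: contrapT => none.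
  have le : coord (- M.+1%:Z) y <= 2 * B.
    rewrite (_ : - M.+1%:Z = - M.+2%:Z + 1); last by lia.
    apply: coord_forward; apply: contrapT => gt.
    by apply: none; exists (- M.+2%:Z).
  have := @chain_cross (- M.+1%:Z) y o le (chain_right M).
  have := chs (- M.+1%:Z); rewrite normrN (metric_sym (q _) o) => /(_ _)/wrap[].
    by rewrite /= ler_nat.
  have := mdist_ge0 y (q (- M.+1%:Z)); lra.
have n01 : n0 < n1.
  by rewrite ltNge; apply/negP => le; apply: n0r; exact: coord_forward_leq n1l.
have [i [Qi Qi1]] : exists i : nat, ~ (coord (n0 + i) y <= l / 2) /\
    ~ ~ (coord (n0 + i.+1) y <= l / 2).
  apply: (@discrete_crossing _ `|n1 - n0|%N); first by rewrite addr0.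
  apply; rewrite (_ : n0 + `|n1 - n0|%N = n1) //; lia.
move/contrapT in Qi1.
exists (n0 + i.+2%:Z); split=> n ni.
  rewrite -(subrK 1 n); apply: coord_forward; apply: coord_forward_leq Qi1.
  by move: ni; clear; lia.
apply: coord_backward; rewrite leNgt; apply/negP => /ltW lt; apply: Qi.
by apply: coord_forward_leq lt; move: ni; clear; lia.
Qed.

(** The orbit of [x0] follows the chain at a bounded distance; the extra point is
what makes arbitrary conjugates of [k] accessible. *)
Section Translate.
Context (x0 : Y).
Local Notation e := (fun n : int => act (zpow k n) x0).
Let T := mdist o x0.
Let D0 := 7 * B + 2 * T + 3 * len k.

Let deq n : mdist (e n) (q n) = T.
Proof. by rewrite act_mdist // metric_sym. Qed.

Let lip (m n : int) (j : nat) : (`|m - n| <= j)%N -> mdist (q m) (q n) <= len k * j%:R.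
Proof.
move=> le; apply: le_trans (orb_lipschitz o isom k m n) _.
by rewrite ler_wpM2l ?len_ge0 // -abszE -pmulrn ler_nat.
Qed.

(** On both sides of the threshold [i] of [y], a path from [y] to [q m] passes by
[q i] (or [q (i - 3)]), so [q m] can only be nearest if it is close to it. *)
Lemma nearest_chain y m (i : int) : nearest e y m ->
  (forall n, i <= n -> coord n y <= 2 * B) ->
  (forall n, n <= i - 3 -> l - 2 * B <= coord n y) ->
  mdist (q m) (q i) <= D0.
Proof.
move=> nm yl yr; rewrite /D0.
have k0 := len_ge0 k; have T0 : 0 <= T := mdist_ge0 _ _; have B1' := B1.
have cmp n : mdist y (q m) <= mdist y (q n) + 2 * T.
  have := nm n; have := metric_triangle y (e m) (q m).
  have := metric_triangle y (q n) (e n); rewrite deq (metric_sym (q n)) deq; lra.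
have [im|mi] := ltP i m.
  have := @chain_cross i y (q m) (yl _ (lexx _)); rewrite coord_shift.
  rewrite (_ : i - m = - (`|m - i|%N.-1).+1%:Z); last by move: im; clear; lia.
  by move=> /(_ (chain_right _)); rewrite (metric_sym (q m)); have := cmp i; lra.
pose j := i - 3.
have [jm|mj] := ltP j m.
  have : mdist (q m) (q i) <= len k * 3%:R.
    by apply: lip; move: jm mi; rewrite /j; clear; lia.
  lra.
have := @chain_cross j (q m) y; rewrite coord_shift.
rewrite (_ : j - m = `|j - m|%N); last by move: mj; clear; lia.
move=> /(_ (chain_left _) (yr _ (lexx _))).
have : mdist (q j) (q i) <= len k * 3%:R by apply: lip; rewrite /j; clear; lia.
have := metric_triangle (q m) (q j) (q i).
by have := cmp j; rewrite (metric_sym y) (metric_sym y); lra.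
Qed.

Lemma chain_projection_ineq : projection_ineq (14 * B + 4 * (D0 + T) + 6 * len k) e.
Proof.
have k0 := len_ge0 k; have T0 : 0 <= T := mdist_ge0 _ _; have B1' := B1.
have D00 : 0 <= D0 by rewrite /D0; lra.
move=> x y m n nm nn big.
have [i [xl xr]] := chain_threshold x; have [j [yl yr]] := chain_threshold y.
wlog : x y m n i j nm nn big xl xr yl yr / i <= j => [wl|ij].
  have [ij|/ltW ji] := leP i j; first exact: (wl x y m n i j).
  have := wl y x n m j i nn nm; rewrite (metric_sym (e n)) => /(_ big yl yr xl xr ji).
  by rewrite (metric_sym y (e n)) (metric_sym (e m) x) (metric_sym y x); lra.
have xi := nearest_chain nm xl xr; have yj := nearest_chain nn yl yr.
have tri a b : mdist (e a) (q b) <= T + mdist (q a) (q b).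
  by have := metric_triangle (e a) (q a) (q b); rewrite deq; lra.
have mi := tri m i; have nj := tri n j.
have [small|far] := ltP (j - 3) i.
  have : mdist (q i) (q j) <= len k * 3%:R by apply: lip; move: ij small; clear; lia.
  have := metric_triangle (e m) (q i) (e n); have := metric_triangle (q i) (q j) (e n).
  by rewrite (metric_sym (q j) (e n)); lra.
pose j' := j - 3.
have jj : mdist (q j') (q j) <= len k * 3%:R by apply: lip; rewrite /j'; clear; lia.
have c1 := @chain_cross i x y (xl _ (lexx _)) (yr _ far).
have := @chain_cross j' (q i) y; rewrite coord_shift.
rewrite (_ : j' - i = `|j' - i|%N); last by move: far; rewrite /j'; clear; lia.
move=> /(_ (chain_left _) (yr _ (lexx _))) c2.
have := metric_triangle x (q i) (e m); rewrite (metric_sym (q i)).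
have := metric_triangle (e m) (q i) (e n).
have := metric_triangle (q i) (q j') (e n).
have := metric_triangle (q j') (q j) (e n).
have := metric_triangle (e n) (q j) y.
have := metric_triangle (q j) (q j') y.
rewrite (metric_sym (q j) (q j')) (metric_sym (q j) (e n)); lra.
Qed.

Lemma chain_translate_spread (m n : int) :
  `|m - n|%:~R - 2 * T <= mdist (e m) (e n).
Proof.
have := chain_spread m n; have := metric_triangle (q m) (e m) (q n).
have := metric_triangle (e m) (e n) (q n).
rewrite (metric_sym (q m) (e m)) !deq; lra.
Qed.

End Translate.

Theorem link_contracting t : contracting_element act o (t * k * t^-1)%g.
Proof.
set g := (t * k * t^-1)%g; pose x0 := act t^-1%g o.
have k0 := len_ge0 k; have T0 := mdist_ge0 o x0; have B1' := B1.
have orbE n : orb g n = act t (act (zpow k n) x0).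
  by rewrite /orbit_point zpow_conj /x0 !actM.
have orbdE m n : mdist (orb g m) (orb g n) =
    mdist (act (zpow k m) x0) (act (zpow k n) x0) by rewrite !orbE act_mdist.
have spr (m n : int) : `|m - n|%:~R - 2 * mdist o x0 <= mdist (orb g m) (orb g n).
  by rewrite orbdE; exact: chain_translate_spread.
have sprg : spread (orb g).
  by exists 1, (2 * mdist o x0); split=> // m n; rewrite mul1r.
split.
  rewrite cyclic_orbitE.
  set D := 14 * B + 4 * ((7 * B + 2 * mdist o x0 + 3 * len k) + mdist o x0) + 6 * len k.
  apply: (@projection_ineq_contracting _ _ D) => //; first by rewrite /D; lra.
  have nearE y m : nearest (orb g) y m ->
      nearest (fun n => act (zpow k n) x0) (act t^-1%g y) m.
    by move=> nm n; rewrite !act_mdistV // -!orbE.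
  move=> x y m n /nearE nm /nearE nn; rewrite orbdE => big.
  have := chain_projection_ineq nm nn big.
  rewrite -(act_mdist isom t (act (zpow k n) x0)) actKV // !act_mdistV // actKV //.
  by rewrite -!orbE.
exists (1 + len g), (2 * mdist o x0); split.
- by have := len_ge0 g; lra.
- lra.
move=> m n; apply/andP; split.
  apply: le_trans (spr m n); rewrite lerD2r ler_piMl ?ler0z //.
  by rewrite invf_le1; have := len_ge0 g; lra.
apply: le_trans (orb_lipschitz o isom g m n) _; rewrite -/(len g).
have : (0 : R) <= `|m - n|%:~R by rewrite ler0z.
rewrite mulrDl mul1r; lra.
Qed.

End PeriodicChain.

(** The hypotheses place the segment of the axis of [t] on the way from [o] to
[g o], well before the middle.  Put [x = t^-1 o] and [k = t^-1 g t]; then the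
segment is on the way from [x] to [k x].  The two conditions of [link] on the
axis hold because [k o] is at distance [len t] from [k x], which is too short to
travel back to the segment.  If a condition on the translated axis fails, then
the way from [o] to [k x] passes by [k o], and this shortens [k]. *)
Lemma conjugator_dichotomy g t : 20 * K < l ->
  rho (act t^-1%g o) <= 0 -> l <= rho (act (t^-1 * g)%g o) ->
  2 * len t <= len g - 2 * l - 10 * K ->
  contracting_element act o g \/
  len (t^-1 * g * t)%g <= len g - 2 * len t + 2 * l + 14 * K.
Proof.
move=> Kl x_le y_ge tg; have K1 := axis_K ax.
set k := (t^-1 * g * t)%g.
have [|bad] := leP (len k) (len g - 2 * len t + 2 * l + 14 * K); first by right.
left; have -> : g = (t * k * t^-1)%g by rewrite /k !mulgA mulgV mul1g mulgK.
apply: (@link_contracting K k) => //.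
set x := act t^-1%g o in x_le; set y := act _ o in y_ge.
have kx : act k x = y by rewrite /k /x /y -actM // mulgK.
have xV : act k^-1%g y = x by rewrite -kx actK.
have dx : mdist x o = len t by rewrite act_mdistV.
have dy : mdist y (act k o) = len t by rewrite -kx act_mdist.
have dxy : mdist x y = len g by rewrite /x /y actM // act_mdist.
have cr : mdist x o + mdist o y <= mdist x y + 7 * K.
  by apply: crossing => //; lra.
have lp := len_pow_le.
have y_base : mdist y o <= ht y + rho y + K.
  by have := dist_base_le y; rewrite ger0_norm //; lra.
have far_y z : rho z < l - K -> mdist y o <= mdist y z + 2 * K + l.
  move=> zl; have := axis_ge ax (x := y) (y := z).
  rewrite ger0_norm; last by lra.
  by move=> /(_ ltac:(lra)); have := axis_ht ax z; lra.
have x_base := dist_base_le x; rewrite ler0_norm // in x_base.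
have far_x z : K < rho z -> mdist z o + mdist x o <= mdist z x + 3 * K.
  move=> zl; have := axis_ge ax (x := z) (y := x).
  rewrite ger0_norm; last by lra.
  move=> /(_ ltac:(lra)); have := dist_base_le z.
  by rewrite ger0_norm; lra.
have tri1 := metric_triangle x o y.
have kz z : mdist (act k^-1%g z) x = mdist z y by rewrite act_mdistV // kx.
rewrite (metric_sym y o) in far_y y_base.
split; rewrite leNgt; apply/negP.
- by move/far_y; lra.
- move/far_y; have := metric_triangle y (act k o) (act k r); rewrite act_mdist // -/(len _).
  by rewrite /orbit_point -/(len (zpow f N)); lra.
- move/far_x; rewrite kz act_mdistV // -/(len k); lra.
- move/far_x; rewrite kz act_mdistV // dx.
  have := metric_triangle r o y; have := metric_triangle o r (act k o).
  rewrite (metric_sym r o) -/(len k) /orbit_point -/(len (zpow f N)); lra.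
Qed.

End Links.

(** * Independent translates of the axis *)

Lemma norm_via (T : realDomainType) (w a z : T) : `|w| <= `|a - w| + `|a - z| + `|z|.
Proof. by norm_cases; lra. Qed.

Section Independence.
Context {R : realType} {Y : metricType R} {G : groupType}.
Context (act : G -> Y -> Y) (o : Y).
Hypothesis isom : isometric_action act.
Hypotheses (Y_proper : proper_space Y) (act_proper : proper_action act).
Local Notation orb := (orbit_point act o).
Local Notation len := (displacement act o).

Lemma finite_len_ball (x : R) : finite_set [set g | len g <= x].
Proof.
have := act_proper (Y_proper (x := o) (r := x)); apply: sub_finite_set => g /= gx.
exists (act g o); split=> //=; exists o => //=; rewrite mdistxx.
exact: le_trans (len_ge0 act o g) gx.
Qed.

Definition orbit_ball_seq (x : R) : seq G := fset_set [set g | len g <= x].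

Local Notation ballseq := orbit_ball_seq.

Lemma mem_ballseq x g : (g \in ballseq x) = (len g <= x).
Proof.
rewrite /orbit_ball_seq [LHS]in_fset_set; last exact: finite_len_ball.
by apply/idP/idP; rewrite inE.
Qed.

Lemma ballseq_uniq x : uniq (ballseq x). Proof. exact: fset_uniq. Qed.

Context (f : G) (tau K : R) (rho ht : Y -> R).
Hypothesis ax : axis_coordinates act o f tau K rho ht.

Lemma orb_line (m n : int) :
  tau * `|m - n|%:~R - 2 * K <= mdist (orb f m) (orb f n) <= tau * `|m - n|%:~R + 2 * K.
Proof.
rewrite orb_mdist0 // distrC; set j := n - m.
have -> : tau * `|j|%:~R = `|tau * j%:~R|.
  by rewrite normrM gtr0_norm ?(axis_tau ax) // intr_norm.
have := base_coordinate isom ax; have := axis_orbit_le ax o j; have := axis_orbit_ge ax o j.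
have := axis_ht ax o; have := axis_K ax; set x := tau * _.
by have [[? ->]|[? ->]] := normP (rho o - x); have [[? ->]|[? ->]] := normP x; have [[? ->]|[? ->]] := normP (rho o); lra.
Qed.

Lemma multiple_gt (p : int) (x : R) : p != 0 ->
  exists i : nat, x < tau * `|p * i|%:~R.
Proof.
move=> p0; have tau0 := axis_tau ax.
have [i Hi] := exists_nat_gt (x / tau); exists i.
rewrite mulrC -ltr_pdivrMr //; apply: (lt_le_trans Hi).
rewrite normrM intrM -[i%:R]mul1r /= ler_wpM2r // -[1]/(1%:~R) ler_int.
by move: p0; clear; lia.
Qed.

Lemma zpow_neq1 p : p != 0 -> zpow f p <> 1%g.
Proof.
move=> p0 fp; have [i Hi] := multiple_gt (2 * K) p0.
have := orb_line 0 (p * i); rewrite /orbit_point zpowM fp.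
have -> : zpow (1%g : G) i = 1%g by rewrite zpow_nat expg1n.
rewrite zpow0 mdistxx sub0r normrN; lra.
Qed.

(** The translate of the axis by [a] is parallel to the axis. *)
Definition commensurates a : Prop :=
  exists p q : int, [/\ p != 0, q != 0 & (a * zpow f p * a^-1)%g = zpow f q].

Lemma commensuratesV a : commensurates a^-1%g -> commensurates a.
Proof.
move=> [p [q [p0 q0 E]]]; exists q, p; split => //.
by rewrite -E invgK !mulgA mulgV mul1g mulgK.
Qed.

(** Far away on both sides, the axis and its translate by [a] stay at distance
[len a]; the point [o] in between is then close to the translate, with a bound that
does not depend on [a]. *)
Lemma commensurates_near a : commensurates a ->
  exists n, len (a * zpow f n)%g <= 5 * K.
Proof.
move=> [p [q [p0 _ E]]]; have K1 := axis_K ax.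
have Ei (i : int) : (a * zpow f (p * i) = zpow f (q * i) * a)%g.
  by rewrite !zpowM -E zpow_conj mulgVK.
pose z := act a^-1%g o; pose x (i : int) := act a^-1%g (orb f (q * i)).
have xi (i : int) : ht (x i) + `|rho (x i) - tau * (p * i)%:~R| <= len a + K.
  apply: le_trans (axis_orbit_ge ax _ _) _; rewrite lerD2r act_mdistV //.
  by rewrite /orbit_point -actM // Ei actM // act_mdist.
have [i Hi] := multiple_gt (len a + 2 * K + `|rho z|) p0.
have x0 := xi i; have x1 := xi (- i%:Z).
have dx (j : int) : mdist (x j) z = mdist (orb f (q * j)) o by rewrite act_mdist.
have dxx : mdist (x i) (x (- i%:Z)) = mdist (orb f (q * i)) (orb f (q * - i%:Z)).
  by rewrite act_mdist.
have btw : mdist (x i) z + mdist z (x (- i%:Z)) <= mdist (x i) (x (- i%:Z)) + 6 * K.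
  rewrite (metric_sym z) !dx dxx.
  have := orb_line (q * i) 0; have := orb_line (q * - i%:Z) 0.
  have := orb_line (q * i) (q * - i%:Z).
  have -> : `|q * i - q * - i%:Z|%:~R = 2 * `|q * i|%:~R :> R.
    by rewrite mulrN opprK -mulr2n normrMn rmorphMn /= mulr_natl.
  rewrite !subr0 mulrN normrN orb0 //; lra.
have pn : (p * - i%:Z)%:~R = - (p * i)%:~R :> R by rewrite mulrN rmorphN.
have far (j : int) : tau * `|p * i|%:~R <= `|tau * (p * j)%:~R| ->
    K < `|rho (x j) - rho z|.
  move=> le; have := xi j; have := axis_ht ax (x j).
  have : `|tau * (p * j)%:~R| <= `|rho (x j) - tau * (p * j)%:~R| + `|rho (x j) - rho z| + `|rho z|.
    exact: norm_via.
  lra.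
have tauE (j : int) : `|tau * j%:~R| = tau * `|j|%:~R.
  by rewrite normrM gtr0_norm ?(axis_tau ax) // intr_norm.
have := axis_ge ax (far i _); rewrite tauE lexx => /(_ isT) g1.
have := axis_ge ax (far (- i%:Z) _); rewrite tauE mulrN normrN lexx => /(_ isT) g2.
have := axis_le ax (x i) (x (- i%:Z)).
have := ler_distD (rho z) (rho (x i)) (rho (x (- i%:Z))).
rewrite (distrC (rho z)) => t1 t2; rewrite (metric_sym z) in btw.
have [n [_ zn]] := axis_foot ax z.
exists n; have -> : len (a * zpow f n)%g = ht z by rewrite -zn act_mdistV // /displacement actM.
lra.
Qed.

Lemma bounded_initial (u : nat -> R) n : exists M, forall i, (i <= n)%N -> u i <= M.
Proof.
elim: n => [|n [M HM]].
  by exists (u 0%N) => i; rewrite leqn0 => /eqP ->.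
exists (Num.max M (u n.+1)) => i; rewrite leq_eqVlt => /orP[/eqP ->|/HM le].
  by rewrite le_max lexx orbT.
by rewrite le_max le.
Qed.

(** If the projection of a ray of the translated axis were unbounded, an initial
segment of the ray would follow the axis at distance at most [D].  The points
[a f^(sg i)], pulled back by suitable powers of [f], would lie in a fixed ball;
among more of them than the ball has elements two coincide, and this
commensurates. *)
Lemma bounded_ray a (sg : int) : ~ commensurates a -> `|sg| = 1 ->
  exists M, forall n : nat, `|rho (act a (orb f (sg * n)))| <= M.
Proof.
move=> nc sg1; have K1 := axis_K ax; have tau0 := axis_tau ax.
pose z (n : nat) := act a (orb f (sg * n)).
set D := ht (act a o) + 9 * K; set W := size (ballseq D).
have [m Hm] := bounded_initial (fun n => `|rho (z n)|) W.
exists (m + K) => n; rewrite leNgt; apply/negP => big.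
have line (i j : nat) : (i <= j)%N ->
    tau * (j%:R - i%:R) - 2 * K <= mdist (z i) (z j) <= tau * (j%:R - i%:R) + 2 * K.
  move=> ij; have := orb_line (sg * i) (sg * j).
  rewrite act_mdist // -mulrBr normrM sg1 mul1r distrC.
  by rewrite ger0_norm ?subr_ge0 // intrB.
have z0 : z 0%N = act a o by rewrite /z mulr0 orb0.
have Wn : (W <= n)%N.
  by rewrite leqNgt; apply/negP => /ltnW/Hm; rewrite /z; have := big; lra.
have far (i : nat) : (i <= W)%N -> K < `|rho (z i) - rho (z n)|.
  move=> /Hm iW; have := ler_distD 0 (rho (z n)) (rho (z i)).
  have := ler_normB (rho (z n)) (rho (z i) ).
  have := lerB_normD (rho (z n)) (- rho (z i)).
  by rewrite normrN distrC; move: big; rewrite -/(z n); lra.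
have close (i : nat) : (i <= W)%N -> ht (z i) <= D.
  move=> iW; have in' := leq_trans iW Wn.
  have := line 0%N i (leq0n _); have := line i n in'; have := line 0%N n (leq0n _).
  have := axis_ge ax (far i iW); have := axis_ge ax (far 0%N (leq0n _)).
  have := axis_le ax (z 0%N) (z n); have := axis_ge ax (x := z 0%N) (y := z i).
  have := ler_distD (rho (z i)) (rho (z 0%N)) (rho (z n)).
  have := axis_ht ax (z 0%N); rewrite /D -z0 !subr0.
  have [_|small] := ltP K (`|rho (z 0%N) - rho (z i)|).
    by move=> ? ? /(_ isT); lra.
  by have := mdist_ge0 (z 0%N) (z i); lra.
have foot (i : 'I_W.+1) : exists k : int, len (zpow f (- k) * (a * zpow f (sg * i)))%g <= D.
  have [k [_ zk]] := axis_foot ax (z i); exists k.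
  have := close i (ltn_ord i); rewrite -zk metric_sym -(act_mdist isom (zpow f (- k))) act_orb // addNr orb0 //.
  by rewrite /displacement !actM.
have [k Hk] := choice foot.
pose phi (i : 'I_W.+1) := (zpow f (- k i) * (a * zpow f (sg * i)))%g.
have phi_inj : injective phi.
  move=> i j E; apply/eqP; apply/negPn/negP => ij; apply: nc.
  exists (sg * i - sg * j), (k i - k j).
  have E1 : (a * zpow f (sg * i - sg * j) * a^-1)%g = zpow f (k i - k j).
    have E' : (a * zpow f (sg * i))%g = (zpow f (k i - k j) * a * zpow f (sg * j))%g.
      by rewrite zpowD -2!mulgA -[(zpow f (- k j) * _)%g]E /phi zpowN mulVKg.
    rewrite (zpowD f (sg * i)) mulgA E' -(mulgA _ (zpow f (sg * j))) -zpowD subrr mulg1.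
    by rewrite mulgK.
  split => //.
    rewrite -mulrBr mulf_neq0 //; first by rewrite -normr_eq0 sg1.
    by rewrite subr_eq0; apply: contra ij => /eqP[] /val_inj ->.
  apply/negP => /eqP q0; rewrite q0 zpow0 in E1.
  have : zpow f (sg * i - sg * j) = 1%g.
    by rewrite -(mulKg a (zpow f _)) -[(a * zpow f _)%g](mulgVK a) E1 mul1g mulVg.
  apply: zpow_neq1.
  rewrite -mulrBr mulf_neq0 //; first by rewrite -normr_eq0 sg1.
  by rewrite subr_eq0; apply: contra ij => /eqP[] /val_inj ->.
have : (size (map phi (enum 'I_W.+1)) <= W)%N.
  apply: uniq_leq_size; first by rewrite map_inj_uniq ?enum_uniq.
  by move=> _ /mapP[i _ ->]; rewrite mem_ballseq; exact: Hk.
by rewrite size_map size_enum_ord ltnn.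
Qed.

Lemma bounded_projection a : ~ commensurates a ->
  exists M, forall n, `|rho (act a (orb f n))| <= M.
Proof.
move=> nc; have [M1 H1] := bounded_ray (sg := 1) nc (normr1 _).
have [M2 H2] := bounded_ray (sg := -1) nc (normrN1 _).
exists (Num.max M1 M2) => n; rewrite le_max; apply/orP.
have [n0|n0] := leP 0 n; [left|right].
  by rewrite -(gez0_abs n0) -[X in orb f X]mul1r.
by rewrite -[n]opprK -(ltz0_abs n0) -[X in orb f X]mulN1r.
Qed.

(** If [y] projects far along both axes, then the projection of [y] to each axis
lies on the way from [y] to the other one, so that each height exceeds the
other. *)
Lemma independent_axes b : ~ commensurates b ->
  exists B, forall y, `|rho y| <= B \/ `|rho (act b^-1%g y)| <= B.
Proof.
move=> nc; have K1 := axis_K ax.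
have [M1 H1] := bounded_projection nc.
have [M2 H2] := bounded_projection (fun c => nc (commensuratesV c)).
exists (M1 + M2 + 2 * K) => y; apply/orP; rewrite -implyNb -ltNge.
apply/implyP => big1; rewrite leNgt; apply/negP => big2.
set y' := act _ y in big2.
have M10 : 0 <= M1 by exact: le_trans (normr_ge0 _) (H1 0).
have M20 : 0 <= M2 by exact: le_trans (normr_ge0 _) (H2 0).
have away w z M : `|rho z| <= M -> M + K < `|rho w| ->
    ht w + `|rho w| - M - K <= mdist w z.
  move=> zM wM; have := lerB_dist (rho w) (rho z); have := axis_ht ax z.
  have := axis_ge ax (x := w) (y := z) => ge h0 h1.
  by have := ge ltac:(lra); lra.
have [n' [_ dn']] := axis_foot ax y'; have [n [_ dn]] := axis_foot ax y.
have := away y _ _ (H1 n') ltac:(lra); rewrite -act_mdistV // dn' => g1.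
have := away y' _ _ (H2 n) ltac:(lra); rewrite /y' act_mdist // dn; lra.
Qed.

(** Elements of finitely many translates of the commensurating set lie in finitely
many cosets of the cyclic subgroup by [commensurates_near], so they cannot exhaust
a non-elementary group. *)
Lemma independent_family (n : nat) : non_elementary G ->
  exists a : 'I_n -> G, forall i j, i != j -> ~ commensurates ((a i)^-1 * a j)%g.
Proof.
move=> ne; suff [s [ss ps]] : exists s : seq G, size s = n /\
    forall i j, (i < j < n)%N -> ~ commensurates ((nth 1 s i)^-1 * nth 1 s j)%g.
  exists (fun i => nth 1%g s i) => i j ij.
  have [lt|gt|/val_inj/eqP] := ltngtP i j; last by rewrite (negPf ij).
    by apply: ps; rewrite lt /=.
  move=> c; apply: (ps j i); first by rewrite gt /=.
  by apply: commensuratesV; rewrite invgM invgK.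
elim: n => [|n [s [ss ps]]]; first by exists [::]; split=> // i j; rewrite ltn0 andbF.
have [a Ha] : exists a, forall x, x \in s -> ~ commensurates (x^-1 * a)%g.
  apply: contrapT => none; apply: (ne f).
  pose reps := [seq (x * b)%g | x <- s, b <- ballseq (5 * K)].
  apply: (@sub_finite_set _ _ ((fun g => [set (g * x)%g | x in cyclic_subgroup f]) @` [set` reps])).
    move=> _ [a _ <-].
    have [x [xs [m am]]] : exists x, x \in s /\ exists m, len (x^-1 * a * zpow f m)%g <= 5 * K.
      apply: contrapT => H; apply: none; exists a => x xs c; apply: H; exists x.
      by split => //; exact: commensurates_near.
    exists (a * zpow f m)%g.
      apply/allpairsP; exists (x, x^-1 * a * zpow f m)%g => /=.
      by split => //; [rewrite mem_ballseq|rewrite -!mulgA mulVKg].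
    apply/seteqP; split=> _ [_ [k _ <-] <-].
      exists (zpow f (m + k)); last by rewrite zpowD mulgA.
      by exists (m + k).
    exists (zpow f (- m + k)); first by exists (- m + k).
    by rewrite -mulgA -zpowD addrA subrr add0r.
  by apply: finite_image; exact: finite_seq.
exists (rcons s a); split; first by rewrite size_rcons ss.
move=> i j /andP[ij jn]; rewrite !nth_rcons ss.
have iN : (i < n)%N by move: ij jn; clear; lia.
rewrite iN; have [jn'|jn'] := ltnP j n; first by apply: ps; rewrite ij.
have -> : (j == n) by move: jn jn'; clear; lia.
by apply: Ha; rewrite mem_nth // ss.
Qed.

(** Each of the four relations excludes at most 5 of the 25 pairs. *)
Lemma common_pair (b1 b2 b3 b4 : rel 'I_5) :
  (forall j i i', b1 i j -> b1 i' j -> i = i') ->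
  (forall j i i', b2 i j -> b2 i' j -> i = i') ->
  (forall i j j', b3 i j -> b3 i j' -> j = j') ->
  (forall i j j', b4 i j -> b4 i j' -> j = j') ->
  exists i j, [/\ ~~ b1 i j, ~~ b2 i j, ~~ b3 i j & ~~ b4 i j].
Proof.
move=> h1 h2 h3 h4; apply: contrapT => none.
have one (P : pred 'I_5) : (forall i j, P i -> P j -> i = j) -> (\sum_i P i <= 1)%N.
  move=> uniqP; rewrite -big_mkcond /= sum1_card; apply/card_le1_eqP => i j Pi Pj.
  exact: uniqP.
have : (\sum_(i < 5) \sum_(j < 5) 1 <= \sum_(i < 5) \sum_(j < 5) (b1 i j + b2 i j + b3 i j + b4 i j))%N.
  apply: leq_sum => i _; apply: leq_sum => j _.
  rewrite lt0n; apply/negP => /eqP z; apply: none; exists i, j.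
  by move: z; do 4 case: (_ i j).
have -> : (\sum_(i < 5) \sum_(j < 5) (b1 i j + b2 i j + b3 i j + b4 i j) =
   \sum_(j < 5) \sum_(i < 5) b1 i j + \sum_(j < 5) \sum_(i < 5) b2 i j +
   \sum_(i < 5) \sum_(j < 5) b3 i j + \sum_(i < 5) \sum_(j < 5) b4 i j)%N.
  rewrite [X in (X + _ + _ + _)%N]exchange_big [X in (_ + X + _ + _)%N]exchange_big /=.
  by rewrite -!big_split /=; apply: eq_bigr => i _; rewrite -!big_split.
have le5 (F : 'I_5 -> nat) : (forall i, F i <= 1)%N -> (\sum_i F i <= 5)%N.
  move=> F1; apply: (@leq_trans (\sum_(i < 5) 1)%N); last by rewrite sum_nat_const card_ord.
  by apply: leq_sum => i _; exact: F1.
have := le5 _ (fun j => one (b1^~ j) (h1 j)); have := le5 _ (fun j => one (b2^~ j) (h2 j)).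
have := le5 _ (fun i => one (b3 i) (h3 i)); have := le5 _ (fun i => one (b4 i) (h4 i)).
rewrite /= !sum_nat_const !card_ord; clear; lia.
Qed.

(** Each condition of [link] on [f^N a_i^-1 v a_j] asks one point, depending only on
[j] (or only on [i]), to project near the origin of the axis of [a_i] (or of
[a_j]).  By independence at most one of five axes is bad for a given point. *)
Lemma link_insertion : non_elementary G -> exists (A : seq G) (B : R), K <= B /\
  forall (N : nat) v, exists a a', [/\ a \in A, a' \in A &
    link act o f tau rho N B (zpow f N * (a^-1 * v * a'))%g].
Proof.
move=> ne; have [a Ha] := independent_family 5 ne; have K1 := axis_K ax.
have [B0 HB] : exists B0, forall i j, i != j -> forall y,
    `|rho (act (a i)^-1%g y)| <= B0 \/ `|rho (act (a j)^-1%g y)| <= B0.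
  have pair (p : 'I_5 * 'I_5) : exists B, p.1 != p.2 -> forall y,
      `|rho (act (a p.1)^-1%g y)| <= B \/ `|rho (act (a p.2)^-1%g y)| <= B.
    have [->|np] := eqVneq p.1 p.2; first by exists 0.
    have [B HB] := independent_axes (Ha _ _ np); exists B => _ y.
    have := HB (act (a p.1)^-1%g y).
    by rewrite -actM // invgM invgK -mulgA mulgV mulg1.
  have [F HF] := choice pair.
  exists (\big[Num.max/0]_p F p) => i j ij y.
  by have [le|le] := HF (i, j) ij y; [left|right]; apply: le_trans le _; exact: le_bigmax.
exists (map a (enum 'I_5)), (Num.max 0 B0 + K); split; first by rewrite lerDr le_max lexx.
move=> N v.
pose bad (i : 'I_5) y := B0 < `|rho (act (a i)^-1%g y)|.
have bad1 y i i' : bad i y -> bad i' y -> i = i'.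
  move=> bi bi'; apply/eqP; apply: contraT => /HB/(_ y).
  by rewrite /bad !ltNge in bi bi' => -[]; [move/negP : bi|move/negP : bi'].
have [i [j [n1 n2 n3 n4]]] := @common_pair
  (fun i j => bad i (act (v * a j)%g o)) (fun i j => bad i (act (v * a j)%g (orb f N)))
  (fun i j => bad j (act (v^-1 * a i)%g o))
  (fun i j => bad j (act (v^-1 * a i)%g (orb f (- N%:Z))))
  (fun j => bad1 _) (fun j => bad1 _) (fun i => bad1 _) (fun i => bad1 _).
exists (a i), (a j); split; [by apply: map_f; rewrite mem_enum..|].
rewrite /bad -!leNgt -!actM // in n1 n2 n3 n4.
have B0B : B0 <= Num.max 0 B0 by rewrite le_max lexx orbT.
have shift y : `|rho y| <= B0 -> tau * N%:R - (Num.max 0 B0 + K) <= rho (act (zpow f N) y).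
  move=> yB; have := axis_shift ax y N; rewrite -[(N%:~R : R)]/(N%:R) => sh.
  by move: sh yB; rewrite !ler_norml; lra.
split.
- by rewrite actM //; apply: shift; rewrite -mulgA.
- by rewrite actM //; apply: shift; rewrite -mulgA /orbit_point -actM.
- apply: le_trans (ler_norm _) _; rewrite !invgM invgK -zpowN mulgA.
  by move: n4; rewrite mulgA; lra.
- apply: le_trans (ler_norm _) _; rewrite invgM actM // actK // !invgM invgK.
  by lra.
Qed.

End Independence.

(** * Barriers and the convergence of the barrier-free sum *)

Lemma exp_le_linear (R : realType) (z a b : R) :
  0 <= a -> 0 <= b -> (forall k : nat, z ^+ k <= a * k%:R + b) -> z <= 1.
Proof.
move=> a0 b0 H; rewrite leNgt; apply/negP => z1.
pose d := z - 1; have d0 : 0 < d by rewrite subr_gt0.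
(* Bernoulli for [k] gives a quadratic lower bound for the exponent [2 * k] *)
have bern (k : nat) : 1 + d * k%:R <= z ^+ k.
  elim: k => [|k IH]; first by rewrite mulr0 addr0 expr0.
  rewrite exprS -natr1; have : z * (1 + d * k%:R) <= z * z ^+ k by rewrite ler_pM2l //; lra.
  have : 0 <= d * (d * k%:R) by rewrite !mulr_ge0 // ltW.
  have -> : z = 1 + d by rewrite /d subrKC.
  rewrite !mulrDl !mulrDr !mul1r !mulr1; lra.
have d2 : 0 < d * d by rewrite mulr_gt0.
have [k Hk] := exists_nat_gt ((2 * a + b + 1) / (d * d)).
rewrite ltr_pdivrMr // [k%:R * _]mulrC in Hk.
have k0 : 0 <= (k%:R : R) by [].
have k1 : (1 : R) <= k%:R.
  rewrite ler1n lt0n; apply/eqP => k0'; rewrite k0' mulr0 in Hk; lra.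
have := H (2 * k)%N; rewrite mulnC exprM.
have : d * k%:R * (d * k%:R) <= z ^+ k * z ^+ k.
  have dk : 0 <= d * k%:R by rewrite mulr_ge0 // ltW.
  by have := bern k => bk; apply: ler_pM => //; lra.
have : (2 * a + b + 1) * k%:R < d * d * k%:R * k%:R by rewrite ltr_pM2r //; lra.
have -> : d * k%:R * (d * k%:R) = d * d * k%:R * k%:R by ring.
have : b + 1 <= (b + 1) * k%:R by rewrite ler_peMr //; lra.
rewrite expr2 natrM; lra.
Qed.

Section Barriers.
Context {R : realType} {Y : metricType R} {G : groupType}.
Context (act : G -> Y -> Y) (o : Y).
Hypothesis isom : isometric_action act.
Hypotheses (Y_proper : proper_space Y) (act_proper : proper_action act).
Local Notation orb := (orbit_point act o).
Local Notation len := (displacement act o).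
Local Notation ballseq := (orbit_ball_seq act o).
Context (f : G) (tau K : R) (rho ht : Y -> R).
Hypothesis ax : axis_coordinates act o f tau K rho ht.

Definition axis_barrier (N : nat) (D : R) x y t : Prop :=
  mdist x (act t o) + len (zpow f N) + mdist (act t (orb f N)) y <= mdist x y + D.

Local Notation barrier := axis_barrier.

Definition barrier_free N D v : Prop := forall t, ~ barrier N D o (act v o) t.

Section Multiplicity.
Context (N : nat) (B alpha : R).
Let l : R := tau * N%:R.
Hypotheses (KB : K <= B) (Bl : 20 * B < l).

(** Let [s] and [s'] be two possible first syllables of a word ending at [e].  Both
[s o] and [s' o] are on the way from [o] to [e], and [s o] comes first.  If [s' o]
projects to the axis of [s] beyond the end of its segment, this segment is a
barrier for [v'], up to the lengths of [a'] and [b'].  Otherwise [s' o] is stuck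
between [s o] and the end of the segment. *)
Lemma barrier_free_multiplicity s s' a' v' b' e :
  link act o f tau rho N B s -> link act o f tau rho N B s' ->
  s' = (zpow f N * (a'^-1 * v' * b'))%g -> len a' <= alpha -> len b' <= alpha ->
  barrier_free N (15 * B + 4 * alpha) v' ->
  l - 2 * B <= rho (act s^-1%g e) -> l - 2 * B <= rho (act s'^-1%g e) ->
  len s <= len s' -> mdist (act s o) (act s' o) <= 2 * l + 21 * B.
Proof.
move=> [_ _ so sr] [_ _ so' _] Es' la' lb' free se se' ss'.
have := KB; have := Bl => Bl' KB'; have K1 := axis_K ax.
pose q' := act s^-1%g (act s' o).
have [far|near] := leP (l - 4 * B) (rho q').
  case: (free (a' * zpow f (- N%:Z) * s)%g).
  pose x := act s^-1%g (orb f N).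
  have g1 : mdist x o + len (zpow f N) + mdist (orb f N) q' <= mdist x q' + 15 * B.
    have := axis_ge ax (x := x) (y := q'); rewrite distrC ger0_norm; last by rewrite /x; lra.
    move=> /(_ ltac:(rewrite /x; lra)).
    have := dist_base_le isom ax x; have := dist_end_le ax N q'; have := len_pow_le isom ax N.
    rewrite (metric_sym q') -/l -/x in sr *.
    by have [[? ->]|[? ->]] := normP (rho x); have [[? ->]|[? ->]] := normP (rho q' - l); lra.
  (* [u] moves the subpath from [f^N o] to [s' o] onto one from [a' o] to
     [v' b' o] *)
  pose u := (a' * zpow f (- N%:Z))%g.
  rewrite -(act_mdist isom s) -[mdist x q'](act_mdist isom s) -[mdist (orb f N) q'](act_mdist isom s) /x /q' !actKV // in g1.
  rewrite -[X in X + _ + _](act_mdist isom u) -[X in _ + X <= _](act_mdist isom u) in g1.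
  rewrite -[X in _ <= X + _](act_mdist isom u) in g1.
  have uN : act u (orb f N) = act a' o by rewrite /u actM // act_orb // addNr orb0.
  have us' : act u (act s' o) = act v' (act b' o).
    by rewrite -!(actM isom) /u Es' zpowN -!mulgA mulKg mulVKg.
  rewrite uN us' -!(actM isom u s) in g1.
  have d2 : mdist (act v' (act b' o)) (act v' o) = len b' by rewrite act_mdist // metric_sym.
  rewrite /axis_barrier -/u.
  have := metric_triangle o (act a' o) (act (u * s)%g o).
  have := metric_triangle (act (u * s)%g (orb f N)) (act v' (act b' o)) (act v' o).
  have := metric_triangle (act a' o) o (act v' (act b' o)).
  have := metric_triangle o (act v' o) (act v' (act b' o)).
  rewrite (metric_sym (act a' o) o) (metric_sym (act v' o) (act v' (act b' o))) d2 -/(len a').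
  lra.
pose eo := act s^-1%g o; pose ee := act s^-1%g e.
rewrite -/eo in so; rewrite -/ee in se.
have g1 : ht q' + (rho ee - rho q') + ht ee <= mdist (act s' o) e + K.
  rewrite -(act_mdist isom s^-1%g); have := axis_ge ax (x := q') (y := ee).
  by rewrite distrC ger0_norm; [apply; lra|lra].
have g2 : mdist o e <= ht eo + (rho ee - rho eo) + ht ee + K.
  rewrite -(act_mdist isom s^-1%g); have := axis_le ax eo ee.
  by rewrite distrC ger0_norm //; lra.
have so2 : rho (act s'^-1%g o) <= 2 * B by lra.
have := crossing isom ax KB Bl so2 se'.
rewrite (act_mdist isom) (act_mdistV isom s' o o) (metric_sym o (act _ e)) (act_mdistV isom s' e o) (metric_sym e) -/(len s') => g3.
have g4 := dist_base_ge isom ax eo; rewrite act_mdistV // -/(len s) in g4.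
have g5 := dist_base_le isom ax q'.
rewrite (metric_sym (act s o)) -(act_mdistV isom s) -/q'.
have h0 := axis_ht ax q'; have := ler_norm (- rho eo); rewrite normrN.
have := g5; have [[? ->]|[? ->]] := normP (rho q'); lra.
Qed.

End Multiplicity.

Section Convergence.
Context (c w : R).
Hypotheses (c0 : 0 < c) (w0 : 0 < w).
Hypothesis growth : forall x : R, (size (ballseq x))%:R <= c * expR (w * x).

Lemma len_bounded (s : seq G) : exists n : nat, forall g, g \in s -> len g <= n%:R.
Proof.
elim: s => [|g t [n Hn]]; first by exists 0%N.
have [m Hm] := exists_nat_gt (len g); exists (maxn m n) => h.
rewrite inE => /orP[/eqP ->|/Hn le].
  by apply: le_trans (ltW Hm) _; rewrite ler_nat leq_maxl.
by apply: le_trans le _; rewrite ler_nat leq_maxr.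
Qed.

Lemma sum_subset_le (F : G -> R) (s t : seq G) : uniq s -> uniq t ->
  {subset s <= t} -> (forall g, 0 <= F g) -> \sum_(g <- s) F g <= \sum_(g <- t) F g.
Proof.
move=> us ut st F0; rewrite (perm_big [seq g <- t | g \in s]) /=.
  rewrite big_filter [leRHS](bigID (fun g => g \in s)) /= lerDl.
  by apply: sumr_ge0.
apply: uniq_perm => //; first exact: filter_uniq.
by move=> g; rewrite mem_filter; case: (boolP (g \in s)) => // /st ->.
Qed.

Lemma sum_const_seq (s : seq G) (x : R) : \sum_(g <- s) x = (size s)%:R * x.
Proof. by rewrite big_const_seq count_predT iter_addr_0 mulr_natl. Qed.

(** Sum by shells [i - 1 < len g <= i]; the predecessor is truncated at 0, where
the shell is the ball of radius 0. *)
Lemma shell_sum (s : R) (n : nat) : 0 <= s ->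
  \sum_(g <- ballseq n%:R) expR (- (s * len g)) <=
  \sum_(i < n.+1) c * expR (w * i%:R - s * i.-1%:R).
Proof.
move=> s0; have len0 := len_ge0 act o.
elim: n => [|n IH].
  rewrite big_ord_recl big_ord0 addr0 /= mulr0 mulr0 subrr expR0 mulr1.
  apply: (@le_trans _ _ (\sum_(g <- ballseq 0) 1)).
    by apply: ler_sum => g _; rewrite -expR0 ler_expR oppr_le0 mulr_ge0.
  by rewrite sum_const_seq mulr1; have := growth 0; rewrite mulr0 expR0 mulr1.
rewrite big_ord_recr /= (bigID (fun g => len g <= n%:R)) /=; apply: lerD.
  apply: le_trans IH; rewrite -big_filter; apply: sum_subset_le.
  - by rewrite filter_uniq // ballseq_uniq.
  - exact: ballseq_uniq.
  - by move=> g; rewrite mem_filter => /andP[gn _]; rewrite mem_ballseq.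
  - by move=> g; exact: expR_ge0.
apply: (@le_trans _ _ (\sum_(g <- ballseq n.+1%:R) expR (- (s * n%:R)))).
  rewrite big_mkcond; apply: ler_sum => g _; case: ifP => [|_]; last exact: expR_ge0.
  by rewrite -ltNge => /ltW le; rewrite ler_expR lerN2 ler_wpM2l.
rewrite sum_const_seq expRD mulrA ler_wpM2r ?expR_ge0 //; exact: growth.
Qed.

Lemma shell_sum_critical (n : nat) :
  \sum_(g <- ballseq n%:R) expR (- (w * len g)) <= c * expR w * n.+1%:R.
Proof.
apply: le_trans (shell_sum n (ltW w0)) _.
apply: (@le_trans _ _ (\sum_(i < n.+1) c * expR w)).
  apply: ler_sum => i _; rewrite ler_pM2l // ler_expR.
  case: (i : nat) => [|j] /=; first by rewrite !mulr0 subr0 ltW.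
  by rewrite -natr1; have := w0; lra.
by rewrite sumr_const card_ord mulr_natr.
Qed.

Lemma shell_sum_double (s : seq G) : uniq s ->
  \sum_(g <- s) expR (- (2 * w * len g)) <= c * expR (2 * w) / (1 - expR (- w)).
Proof.
move=> us; have w0' := w0.
have [n Hn] := len_bounded s.
apply: (@le_trans _ _ (\sum_(g <- ballseq n%:R) expR (- (2 * w * len g)))).
  apply: sum_subset_le => //; first exact: ballseq_uniq.
  by move=> g /Hn; rewrite mem_ballseq.
apply: le_trans (shell_sum n _) _; first by lra.
have q1 : expR (- w) < 1 by rewrite -expR0 ltr_expR; lra.
apply: (@le_trans _ _ (\sum_(i < n.+1) c * expR (2 * w) * expR (- w) ^+ i)).
  apply: ler_sum => i _; rewrite -[leRHS]mulrA ler_pM2l // -expRM_natl -expRD ler_expR.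
  case: (i : nat) => [|j] /=; first by rewrite !mulr0 mul0r subr0 addr0; lra.
  by rewrite -natr1; lra.
rewrite -mulr_sumr ler_pM2l ?mulr_gt0 ?expR_gt0 //.
rewrite -[leRHS]mul1r ler_pdivlMr ?subr_gt0 // mulrC -opprB mulNr -subrX1 opprB.
by rewrite gerBl exprn_ge0 // expR_ge0.
Qed.

(** Words in the syllables [sv v], as a sequence with repetitions.  The hypothesis
[mult] bounds the number of first syllables of a word with a given end point. *)
Section Words.
Context (N : nat) (B D : R) (M : nat) (S : seq G) (sv : G -> G).
Let l : R := tau * N%:R.
Hypotheses (KB : K <= B) (Bl : 20 * B < l).
Hypothesis lks : forall v, link act o f tau rho N B (sv v).
Hypothesis len_sv : forall v, len (sv v) <= len v + D.
Hypothesis mult : forall e,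
  (size [seq v <- S | (l - 2 * B <= rho (act (sv v)^-1%g e))%R] <= M)%N.

Fixpoint words (k : nat) : seq G :=
  if k is k'.+1 then [seq (sv v * u)%g | v <- S, u <- words k'] else [:: 1%g].

Lemma words_right k u : u \in words k -> l - 2 * B <= rho (act u (orb f N)).
Proof.
have := Bl; have := KB; have K1 := axis_K ax => KB' Bl'.
elim: k u => [|k IH] u /=.
  rewrite inE => /eqP ->; rewrite act1 //.
  have := dist_end_ge ax N (orb f N); rewrite mdistxx -/l.
  have := axis_ht ax (orb f N); have := ler_norm (- (rho (orb f N) - l)); rewrite normrN; lra.
move=> /allpairsP[[v u'] /= [_ /IH ur ->]].
apply: (link_backward isom ax KB Bl (lks v)).
by rewrite actM // actK // -/l; lra.
Qed.

Lemma count_words k g : (\sum_(u <- words k) (u == g) <= M ^ k)%N.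
Proof.
elim: k g => [|k IH] g /=; first by rewrite big_seq1 expn0; case: eqP.
rewrite big_allpairs_dep /=.
have E v : (\sum_(u <- words k) ((sv v * u)%g == g) =
            \sum_(u <- words k) (u == ((sv v)^-1 * g)%g))%N.
  apply: eq_bigr => u _; congr nat_of_bool; apply/eqP/eqP => [<-|->].
    by rewrite mulKg.
  by rewrite mulVKg.
rewrite (eq_bigr _ (fun v _ => E v)).
pose P v := l - 2 * B <= rho (act (sv v)^-1%g (act g (orb f N))).
rewrite (bigID P) /= [X in (_ + X <= _)%N]big1 => [|v nP]; last first.
  rewrite big_seq big1 // => u uk; case: eqP => // Eu; case/negP: nP.
  by rewrite /P -actM // -Eu; exact: words_right uk.
rewrite addn0 expnS -big_filter; apply: (@leq_trans (\sum_(v <- [seq v <- S | P v]) M ^ k)%N).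
  by apply: leq_sum => v _; exact: IH.
by rewrite big_const_seq count_predT iter_addn_0 mulnC leq_mul2r mult orbT.
Qed.

Lemma words_len k (La : R) u : (forall v, v \in S -> len v + D <= La) ->
  u \in words k -> len u <= k%:R * La.
Proof.
move=> HLa; elim: k u => [|k IH] u /=.
  by rewrite inE => /eqP ->; rewrite mul0r /displacement act1 // mdistxx.
move=> /allpairsP[[v u'] /= [vS /IH ul ->]].
have := lenM o isom (sv v) u'; have := len_sv v; have := HLa v vS.
by rewrite -natr1 mulrDl; lra.
Qed.

Lemma words_weight k :
  (\sum_(v <- S) expR (- (w * (len v + D)))) ^+ k <=
  \sum_(u <- words k) expR (- (w * len u)).
Proof.
elim: k => [|k IH]; first by rewrite expr0 /= big_seq1 /displacement act1 // mdistxx mulr0 oppr0 expR0.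
rewrite exprS /= big_allpairs_dep /= mulr_suml; apply: ler_sum => v _.
apply: (@le_trans _ _ (expR (- (w * (len v + D))) * \sum_(u <- words k) expR (- (w * len u)))).
  by rewrite ler_pM2l ?expR_gt0.
rewrite mulr_sumr; apply: ler_sum => u _; rewrite -expRD ler_expR -opprD lerN2 -mulrDr.
rewrite ler_pM2l //; have := lenM o isom (sv v) u; have := len_sv v; lra.
Qed.

(** Comparing the weights of words of [k] syllables with those of the elements that
they represent shows that the [k]-th power of the sum is at most [M ^ k] times a
linear function of [k], for every [k]. *)
Lemma words_bound : \sum_(v <- S) expR (- (w * (len v + D))) <= M%:R.
Proof.
set X := \sum_(v <- S) _.
have X0 : 0 <= X by apply: sumr_ge0 => v _; exact: expR_ge0.
have [n Hn] := len_bounded S; have [La lt_La] := exists_nat_gt (n%:R + D).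
have HLa v : v \in S -> len v + D <= La%:R by move/Hn; lra.
have main k : X ^+ k <= M%:R ^+ k * (c * expR w * (k * La).+1%:R).
  apply: le_trans (words_weight k) _.
  apply: (@le_trans _ _ (\sum_(u <- words k) \sum_(g <- ballseq (k * La)%:R) (u == g)%:R * expR (- (w * len g)))).
    rewrite big_seq [leRHS]big_seq; apply: ler_sum => u uk.
    have ub : u \in ballseq (k * La)%:R.
      by rewrite mem_ballseq // natrM; exact: words_len uk.
    rewrite (bigD1_seq u) //= ?ballseq_uniq // eqxx mul1r lerDl.
    by apply: sumr_ge0 => g _; rewrite mulr_ge0 ?expR_ge0.
  rewrite exchange_big /=.
  apply: (@le_trans _ _ (\sum_(g <- ballseq (k * La)%:R) M%:R ^+ k * expR (- (w * len g)))).
    apply: ler_sum => g _; rewrite -mulr_suml ler_wpM2r ?expR_ge0 //.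
    by rewrite -natr_sum -natrX ler_nat; exact: count_words.
  by rewrite -mulr_sumr ler_wpM2l ?exprn_ge0 //; exact: shell_sum_critical.
have [M0|Mpos] := posnP M.
  have := main 1%N; rewrite !expr1 M0 mul0r => X0'; exact: X0'.
have MR : 0 < (M%:R : R) by rewrite ltr0n.
rewrite -[leRHS]mul1r -ler_pdivrMr //.
have cw : 0 < c * expR w by rewrite mulr_gt0 ?expR_gt0.
apply: (@exp_le_linear _ _ (c * expR w * La%:R) (c * expR w)).
- by rewrite mulr_ge0 // ltW.
- exact: ltW.
move=> k; rewrite expr_div_n ler_pdivrMr ?exprn_gt0 // mulrC.
apply: le_trans (main k) _; rewrite ler_pM2l ?exprn_gt0 // -natr1 natrM mulrDr mulr1 lerD2r.
by rewrite -!mulrA [La%:R * _]mulrC.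
Qed.

End Words.

Lemma barrier_free_convergent : non_elementary G ->
  exists B D : R, [/\ K <= B, 0 <= D & forall N : nat, 20 * B < tau * N%:R ->
    exists C : R, forall S : seq G, uniq S ->
      (forall v, v \in S -> barrier_free N D v) ->
      \sum_(v <- S) expR (- (w * len v)) <= C].
Proof.
move=> ne; have K1 := axis_K ax.
have [A [B [KB ins]]] := link_insertion isom Y_proper act_proper ax ne.
have [al Hal] := len_bounded A.
exists B, (15 * B + 4 * al%:R); split => //.
  by rewrite addr_ge0 ?mulr_ge0 //; lra.
move=> N Bl; set l := tau * N%:R in Bl.
have [a Ha] := choice (ins N); have [b Hb] := choice Ha.
pose sv v := (zpow f N * ((a v)^-1 * v * b v))%g.
pose D := len (zpow f N) + 2 * al%:R.
pose M := (size A * size A * size (ballseq (2 * l + 21 * B)))%N.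
exists (M%:R * expR (w * D)) => S uS free.
have lks v : link act o f tau rho N B (sv v) by case: (Hb v).
have la v : len (a v) <= al%:R by case: (Hb v) => /Hal.
have lb v : len (b v) <= al%:R by case: (Hb v) => _ /Hal.
have len_sv v : len (sv v) <= len v + D.
  rewrite /sv; have := lenM o isom (zpow f N) ((a v)^-1 * v * b v)%g.
  have := lenM o isom ((a v)^-1 * v)%g (b v); have := lenM o isom (a v)^-1%g v.
  by rewrite lenV //; have := la v; have := lb v; rewrite /D; lra.
have mult e : (size [seq v <- S | (l - 2 * B <= rho (act (sv v)^-1%g e))%R] <= M)%N.
  set T := [seq v <- S | _].
  case E : T => [//|v0 T'].
  have v0T : v0 \in T by rewrite E mem_head.
  rewrite -E; have near v : v \in T -> len ((sv v0)^-1 * sv v)%g <= 2 * l + 21 * B.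
    move: v0T; rewrite !mem_filter lenE // => /andP[r0 /free f0] /andP[r1 /free f1].
    have [le|/ltW le] := leP (len (sv v0)) (len (sv v)).
      exact: (barrier_free_multiplicity KB Bl (lks v0) (lks v) erefl (la v) (lb v) f1 r0 r1 le).
    rewrite metric_sym.
    exact: (barrier_free_multiplicity KB Bl (lks v) (lks v0) erefl (la v0) (lb v0) f0 r1 r0 le).
  pose phi v := (a v, b v, ((sv v0)^-1 * sv v)%g).
  have phi_inj : injective phi.
    move=> v v' [Ea Eb /mulgI]; rewrite /sv Ea Eb => /mulgI/mulIg/mulgI //.
  rewrite -(size_map phi) /M -(size_allpairs pair A A) -(size_allpairs pair).
  apply: uniq_leq_size; first by rewrite map_inj_uniq // filter_uniq.
  move=> _ /mapP[v vT ->]; apply/allpairsP; exists ((a v, b v), ((sv v0)^-1 * sv v)%g).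
  split => //=; last by rewrite mem_ballseq // near.
  by apply/allpairsP; exists (a v, b v); case: (Hb v).
have := words_bound KB Bl lks len_sv mult.
have -> : \sum_(v <- S) expR (- (w * (len v + D))) = (\sum_(v <- S) expR (- (w * len v))) * expR (- (w * D)).
  by rewrite mulr_suml; apply: eq_bigr => v _; rewrite -expRD mulrDr opprD.
by rewrite expRN ler_pdivrMr ?expR_gt0.
Qed.

(** A finite set whose sum is within [e] of the supremum lies in some ball; sets
disjoint from this ball can only add [e] to it. *)
Lemma tail_small (P : G -> Prop) (F : G -> R) C : (forall g, 0 <= F g) ->
  (forall S, uniq S -> (forall v, v \in S -> P v) -> \sum_(v <- S) F v <= C) ->
  forall e, 0 < e -> exists r : nat, forall S, uniq S ->
    (forall v, v \in S -> P v /\ r%:R < len v) -> \sum_(v <- S) F v <= e.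
Proof.
move=> F0 bnd e e0.
pose E := [set x | exists2 S, uniq S /\ (forall v, v \in S -> P v) & x = \sum_(v <- S) F v].
have hE : has_sup E.
  split; first by exists 0, [::]; rewrite ?big_nil.
  by exists C => _ [S [uS PS] ->]; exact: bnd.
have [_ [S0 [u0 P0] ->] lt] := sup_adherent e0 hE.
have [r Hr] := len_bounded S0; exists r => S uS PS.
have : \sum_(v <- S0 ++ S) F v <= sup E.
  apply: ub_le_sup; first exact: hE.2.
  exists (S0 ++ S) => //; split.
    rewrite cat_uniq u0 uS andbT /=; apply/hasPn => v /PS[_ rv].
    by apply/negP => /Hr; rewrite leNgt rv.
  by move=> v; rewrite mem_cat => /orP[/P0|/PS[]].
by rewrite big_cat /=; lra.
Qed.

End Convergence.
End Barriers.

(** * Barriers of a given element *)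

Lemma seq_argmax (T : eqType) (R : realDomainType) (F : T -> R) (s : seq T) x0 :
  x0 \in s -> exists2 x, x \in s & forall y, y \in s -> F y <= F x.
Proof.
elim: s x0 => [//|a s IH] x0 _.
case: s IH => [_|b s IH].
  by exists a; rewrite ?mem_head // => y; rewrite inE => /eqP ->.
have [x xs Hx] := IH b (mem_head _ _).
have [le|/ltW le] := leP (F x) (F a).
  exists a; first exact: mem_head.
  by move=> y; rewrite inE => /orP[/eqP -> //|/Hx ley]; exact: le_trans le.
exists x; first by rewrite inE xs orbT.
by move=> y; rewrite inE => /orP[/eqP -> //|/Hx].
Qed.

Section Decomposition.
Context {R : realType} {Y : metricType R} {G : groupType}.
Context (act : G -> Y -> Y) (o : Y).
Hypothesis isom : isometric_action act.
Hypotheses (Y_proper : proper_space Y) (act_proper : proper_action act).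
Local Notation orb := (orbit_point act o).
Local Notation len := (displacement act o).
Local Notation ballseq := (orbit_ball_seq act o).
Context (f : G) (tau K : R) (rho ht : Y -> R).
Hypothesis ax : axis_coordinates act o f tau K rho ht.
Local Notation barrier := (axis_barrier act o f).

(** A barrier expressed by coordinates: whatever [x] and [y], it has the fixed
quality of [crosses_dist]. *)
Definition crosses (N : nat) (E : R) x y t : Prop :=
  rho (act t^-1%g x) <= - E /\ tau * N%:R + E <= rho (act t^-1%g y).

Lemma crosses_dist N E x y t : 20 * K < tau * N%:R -> 0 <= E -> crosses N E x y t ->
  mdist x (act t o) + mdist (act t o) y <= mdist x y + 7 * K.
Proof.
move=> Kl E0 [xE yE]; have K1 := axis_K ax.
have := crossing isom ax (lexx K) Kl (x := act t^-1%g x) (y := act t^-1%g y).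
rewrite (act_mdist isom) (act_mdistV isom t x o) (metric_sym o (act _ y)).
rewrite (act_mdistV isom t y o) (metric_sym y).
by apply; lra.
Qed.

Lemma crosses_far N E x y t : crosses N E x y t ->
  E - K <= mdist x (act t o) /\ tau * N%:R + E - K <= mdist (act t o) y.
Proof.
move=> [xE yE].
have := dist_base_ge isom ax (act t^-1%g x); have := dist_base_ge isom ax (act t^-1%g y).
rewrite (act_mdistV isom t x o) (act_mdistV isom t y o) (metric_sym y); have := axis_ht ax (act t^-1%g x).
have := axis_ht ax (act t^-1%g y); have := ler_norm (rho (act t^-1%g y)).
have := ler_norm (- rho (act t^-1%g x)); rewrite normrN; lra.
Qed.

(** A barrier of arbitrary quality [D] for a power [N + 2 * j] large with respect to
[D] contains, after removing [j] steps at both ends, a crossing of the smaller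
power [N]. *)
Lemma barrier_crosses (D E : R) : 0 <= D -> exists j : nat,
  forall (N : nat) x y t, barrier (N + 2 * j) D x y t ->
    crosses N E x y (t * zpow f j)%g.
Proof.
move=> D0; have K1 := axis_K ax; have tau0 := axis_tau ax.
have [j Hj] := exists_nat_gt ((D + 7 * K + `|E|) / tau); exists j => N x y t bar.
rewrite ltr_pdivrMr // in Hj; have E1 := ler_norm E; have E0 := normr_ge0 E.
pose x' := act t^-1%g x; pose y' := act t^-1%g y.
have l2 : tau * (N + 2 * j)%:R = tau * N%:R + 2 * (j%:R * tau).
  by rewrite natrD natrM mulrDr; ring.
have Npos : 0 <= tau * N%:R by rewrite mulr_ge0 // ltW.
have {bar} bar : mdist x' o + len (zpow f (N + 2 * j)%N) + mdist y' (orb f (N + 2 * j)%N)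
    <= mdist x' y' + D.
  have := bar; rewrite /axis_barrier /x' /y' (act_mdist isom) (act_mdistV isom t x o).
  by rewrite (act_mdistV isom t y) (metric_sym y).
have /andP[l1 _] := orb_line isom ax (N + 2 * j)%N 0.
rewrite subr0 /= orb0 // (metric_sym _ o) -/(len _) -[(_%:~R : R)]/((N + 2 * j)%:R) l2 in l1.
have b1 := dist_base_ge isom ax x'; have b2 := dist_end_ge ax (N + 2 * j) y'.
have b3 := axis_le ax x' y'; rewrite l2 in b2.
have h1 := axis_ht ax x'; have h2 := axis_ht ax y'.
set l := tau * N%:R in Npos l1 b2 l2; set J := j%:R * tau in Hj l1 b2 l2.
have [xle yge] : rho x' <= (D + 6 * K) / 2 /\ l + 2 * J - (D + 6 * K) / 2 <= rho y'.
  clear -l1 b1 b2 b3 h1 h2 bar Hj E0 K1 D0 Npos.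
  move: b1 b2 b3; move: (normP (rho x')) (normP (rho y' - (l + 2 * J))) (normP (rho x' - rho y')).
  by move=> [[? ->]|[? ->]] [[? ->]|[? ->]] [[? ->]|[? ->]]; lra.
have shift z : `|rho (act (t * zpow f j)^-1%g z) - rho (act t^-1%g z) + J| <= K.
  have := axis_shift ax (act t^-1%g z) (- j%:Z).
  by rewrite zpowN -actM // -invgM rmorphN mulrN opprK mulrC.
have := shift x; have := shift y; rewrite -/x' -/y' !ler_norml -/l /crosses -/l.
split; lra.
Qed.

(** Assume that no crossing [t] of [g] with [m <= len t] lies in the first half, as
otherwise [conjugator_dichotomy] applies.  Let [t2] be the first crossing in the
second half (or [g]) and [t1] the last crossing of [t2] in the ball of radius [m]
(or 1).  A barrier of [t1^-1 t2] would contain a crossing of [g] and of [t2]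
strictly between [t1] and [t2], against the choice of one of them.  Barriers for
the power [N' + 2 * j] are used for [u], so that the loss of quality in passing
from [u] to [g] is absorbed by [barrier_crosses]. *)
Lemma barrier_free_decomposition (B D : R) : K <= B -> 0 <= D ->
  exists (N : nat) (C : R), [/\ 20 * B < tau * N%:R, 0 <= C &
    forall (m : R) g, 0 < m -> ~ contracting_element act o g ->
      (exists t, m <= len t /\ len (t^-1 * g * t)%g <= len g - 2 * len t + C) \/
      (exists t u, [/\ len t < m, barrier_free act o f N D u,
         len g / 2 - C - m <= len u &
         len u + len ((t * u)^-1 * g)%g <= len g + C])].
Proof.
move=> KB D0; have K1 := axis_K ax; have tau0 := axis_tau ax.
have [N' HN'] := exists_nat_gt (20 * B / tau); rewrite ltr_pdivrMr // [N'%:R * _]mulrC in HN'.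
set l := tau * N'%:R in HN'.
have [j Hj] := @barrier_crosses (D + 14 * K) (16 * K) ltac:(lra).
have len0 := len_ge0 act o.
have Kl : 20 * K < l by lra.
exists (N' + 2 * j)%N, (2 * l + 14 * K); split.
- rewrite natrD mulrDr; have : 0 <= tau * (2 * j)%:R by rewrite mulr_ge0 // ltW.
  by rewrite -/l; lra.
- lra.
move=> m g m0 nc.
pose Om y t := crosses N' (16 * K) o y t.
have E0 : 0 <= 16 * K by lra.
pose c := l + 5 * K.
pose far := [seq t <- g :: ballseq (len g) | `[< len g / 2 - c < len t /\ (t = g \/ Om (act g o) t) >]].
have gfar : g \in far.
  rewrite mem_filter mem_head andbT; apply/asboolP; split; last by left.
  by have := len0 g; rewrite /c; lra.
have [t2 t2far t2min] := @seq_argmax _ _ (fun t => - len t) _ _ gfar.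
have [t2g t2gt] : len t2 + mdist (act t2 o) (act g o) <= len g + 7 * K /\ len g / 2 - c < len t2.
  move: t2far; rewrite mem_filter => /andP[/asboolP[gt [E|om]] _]; split => //.
    by rewrite E mdistxx -/(len g); lra.
  exact: crosses_dist Kl E0 om.
pose near := [seq t <- 1%g :: ballseq m | `[< len t < m /\ (t = 1%g \/ Om (act t2 o) t) >]].
have len1 : len 1%g = 0 by rewrite /displacement act1 // mdistxx.
have near1 : 1%g \in near.
  by rewrite mem_filter mem_head andbT; apply/asboolP; rewrite len1; split; last left.
have [t1 t1near t1max] := @seq_argmax _ _ (fun t => len t) _ _ near1.
have [t12 t1m] : len t1 + mdist (act t1 o) (act t2 o) <= len t2 + 7 * K /\ len t1 < m.
  move: t1near; rewrite mem_filter => /andP[/asboolP[lt [E|om]] _]; split => //.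
    by rewrite E len1 act1 // -/(len t2); lra.
  exact: crosses_dist Kl E0 om.
pose u := (t1^-1 * t2)%g.
have lu : len u = mdist (act t1 o) (act t2 o) by rewrite /u lenE.
have [free|nfree] := pselect (barrier_free act o f (N' + 2 * j)%N D u).
  right; exists t1, u; split => //.
    have := metric_triangle o (act t1 o) (act t2 o).
    by rewrite -/(len t1) -/(len t2) lu; move: t2gt; rewrite /c; lra.
  have -> : (t1 * u)%g = t2 by rewrite /u mulVKg.
  by rewrite lenE // lu; have := len0 t1; lra.
have [s bs] : exists s, barrier (N' + 2 * j)%N D o (act u o) s.
  by apply: contrapT => H; apply: nfree => s bs; apply: H; exists s.
pose t := (t1 * s * zpow f j)%g.
have b1 : barrier (N' + 2 * j)%N D (act t1 o) (act t2 o) (t1 * s)%g.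
  move: bs; rewrite /axis_barrier /u -(act_mdist isom t1) -[X in _ + X <= _](act_mdist isom t1).
  by rewrite -[X in _ <= X + _](act_mdist isom t1) -!actM // mulVKg.
have b2 : barrier (N' + 2 * j)%N (D + 7 * K) o (act t2 o) (t1 * s)%g.
  move: b1; rewrite /axis_barrier; have := metric_triangle o (act t1 o) (act (t1 * s)%g o).
  by rewrite -/(len t1) -/(len t2); lra.
have b3 : barrier (N' + 2 * j)%N (D + 14 * K) o (act g o) (t1 * s)%g.
  move: b2; rewrite /axis_barrier.
  have := metric_triangle (act (t1 * s)%g (orb f (N' + 2 * j)%N)) (act t2 o) (act g o).
  by rewrite -/(len t2) -/(len g); lra.
have weaken D1 x y t' : D1 <= D + 14 * K -> barrier (N' + 2 * j)%N D1 x y t' ->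
    barrier (N' + 2 * j)%N (D + 14 * K) x y t' by rewrite /axis_barrier; lra.
have c1 : crosses N' (16 * K) (act t1 o) (act t2 o) t by apply/Hj/(weaken _ _ _ _ _ b1); lra.
have c2 : crosses N' (16 * K) o (act t2 o) t by apply/Hj/(weaken _ _ _ _ _ b2); lra.
have c3 : crosses N' (16 * K) o (act g o) t by apply/Hj/(weaken _ _ _ _ _ b3); lra.
have t1t : len t1 < len t.
  have [f1 _] := crosses_far c1; have := crosses_dist Kl E0 c1.
  have := metric_triangle o (act t o) (act t2 o); rewrite -/(len t) -/(len t2); lra.
have tt2 : len t < len t2.
  have [_ f2] := crosses_far c2; have := crosses_dist Kl E0 c2.
  rewrite -/(len t) -/(len t2) -/l in f2 *; lra.
have [mt|tm] := leP m (len t); last first.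
  have : t \in near.
    rewrite mem_filter in_cons mem_ballseq // (ltW tm) orbT andbT.
    by apply/asboolP; split => //; right.
  by move/t1max; rewrite leNgt t1t.
have [tg|gt] := leP (len t) (len g / 2 - c); last first.
  have : t \in far.
    have t2g' : len t2 <= len g.
      move: t2far; rewrite mem_filter in_cons => /andP[_ /orP[/eqP -> //|]].
      by rewrite mem_ballseq.
    rewrite mem_filter in_cons mem_ballseq // (ltW (lt_le_trans tt2 t2g')) orbT andbT.
    by apply/asboolP; split => //; right.
  by move/t2min; rewrite lerN2 leNgt tt2.
left; exists t; split => //; case: c3 => x_le y_ge.
have [|||//|] := @conjugator_dichotomy _ _ _ act o isom f tau K rho ht ax N' g t Kl.
- by apply: le_trans x_le _; lra.
- by rewrite actM // ; apply: le_trans y_ge; rewrite -/l; lra.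
- by move: tg; rewrite -/l /c; lra.
- by rewrite -/l; lra.
Qed.

End Decomposition.

(** * Counting *)

Section Counting.
Context {R : realType} {Y : metricType R} {G : groupType}.
Context (act : G -> Y -> Y) (o : Y).
Hypothesis isom : isometric_action act.
Hypotheses (Y_proper : proper_space Y) (act_proper : proper_action act).
Local Notation orb := (orbit_point act o).
Local Notation len := (displacement act o).
Local Notation ballseq := (orbit_ball_seq act o).

Lemma ncard_ball n : ncard (orbit_ball act o n) = size (ballseq n%:R).
Proof. by []. Qed.

Lemma ncard_ballI n (S : set G) :
  ncard (orbit_ball act o n `&` S) = size [seq g <- ballseq n%:R | g \in S].
Proof.
rewrite /ncard; apply/perm_size/uniq_perm; first exact: fset_uniq.
  by rewrite filter_uniq // ballseq_uniq.
move=> g; rewrite mem_filter mem_ballseq // [LHS]in_fset_set.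
  by rewrite in_setI andbC; congr (_ && _); apply/idP/idP; rewrite inE.
by apply: sub_finite_set (finite_len_ball o Y_proper act_proper n%:R) => ? [].
Qed.

Lemma peg_rate : purely_exponential_growth act o ->
  exists w c1 c2 : R, [/\ 0 < c1, 0 < c2 & forall n : nat,
    c1 * expR (w * n%:R) <= (size (ballseq n%:R))%:R <= c2 * expR (w * n%:R)].
Proof.
move=> [c1 [c2 [c10 c20]]]; case: (growth_rate act o) => [w|/(_ 1%N)|/(_ 1%N)] H.
- by exists w, c1, c2.
- by move: H; rewrite mulyr gtr0_sg // mul1e /= mulry gtr0_sg // mul1e.
- move: H; rewrite mulNyr gtr0_sg // mul1e /= !mule0 => /andP[_].
  rewrite lee_fin ncard_ball lern0 size_eq0 => /eqP b0.
  have : 1%g \in ballseq 1%:R by rewrite mem_ballseq // /displacement act1 // mdistxx.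
  by rewrite b0.
Qed.

Context (f : G) (tau K : R) (rho ht : Y -> R).
Hypothesis ax : axis_coordinates act o f tau K rho ht.

Lemma ball_unbounded (M : nat) : exists n : nat, (M < size (ballseq n%:R))%N.
Proof.
pose s := [seq zpow f i%:Z | i <- iota 0 M.+1].
have [n Hn] := len_bounded act o s; exists n.
have us : uniq s.
  rewrite map_inj_uniq ?iota_uniq // => i j E; apply/eqP/negPn/negP => ij.
  apply: (zpow_neq1 isom ax (p := i%:Z - j%:Z)).
    by rewrite subr_eq0; apply: contra ij => /eqP[->].
  by rewrite zpowD E zpowN mulgV.
have := uniq_leq_size us (s2 := ballseq n%:R).
by rewrite size_map size_iota; apply => g gs; rewrite mem_ballseq // Hn.
Qed.

(** Otherwise balls have bounded size, although the powers of [f] are pairwise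
distinct. *)
Lemma rate_gt0 (w c2 : R) : (forall n : nat, (size (ballseq n%:R))%:R <= c2 * expR (w * n%:R)) ->
  0 < c2 -> 0 < w.
Proof.
move=> H c20; rewrite ltNge; apply/negP => w0.
have [M HM] := exists_nat_gt c2; have [n Mn] := ball_unbounded M.
have : c2 * expR (w * n%:R) <= c2.
  by rewrite ger_pMr // -expR0 ler_expR mulr_le0_ge0.
have : (M%:R : R) < (size (ballseq n%:R))%:R by rewrite ltr_nat.
by have := H n; lra.
Qed.

Lemma real_growth (w c2 : R) : 0 < w -> 0 < c2 ->
  (forall n : nat, (size (ballseq n%:R))%:R <= c2 * expR (w * n%:R)) ->
  forall x : R, (size (ballseq x))%:R <= c2 * expR w * expR (w * x).
Proof.
move=> w0 c20 H x; have [x0|x0] := ltP x 0.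
  have -> : ballseq x = [::].
    apply/eqP; rewrite -size_eq0 -leqn0 leqNgt -has_predT; apply/hasPn => g.
    by rewrite mem_ballseq // => /(le_trans (len_ge0 act o g)); rewrite leNgt x0.
  by rewrite !mulr_ge0 ?expR_ge0 // ltW.
pose n := (Num.trunc x).+1.
have xn : x <= n%:R by exact/ltW/truncnS_gt.
apply: (@le_trans _ _ (size (ballseq n%:R))%:R).
  rewrite ler_nat; apply: uniq_leq_size; first exact: ballseq_uniq.
  by move=> g; rewrite !mem_ballseq // => gx; exact: le_trans xn.
apply: le_trans (H n) _; rewrite -mulrA -expRD ler_pM2l // ler_expR.
rewrite -[X in X + _]mulr1 -mulrDr ler_pM2l // /n -natr1 addrC lerD2l.
by have /andP[] := truncn_itv x0.
Qed.

Context (w c : R).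
Hypotheses (w0 : 0 < w) (c0 : 0 < c).
Hypothesis growth : forall x : R, (size (ballseq x))%:R <= c * expR (w * x).

Lemma size_allpairs_dep_le (U : seq G) (F : G -> G -> G) (x : R) (h : G -> R) :
  (size [seq F u v | u <- U, v <- ballseq (x - h u)])%:R <=
  c * expR (w * x) * \sum_(u <- U) expR (- (w * h u)).
Proof.
rewrite size_allpairs_dep sumnE big_map natr_sum mulr_sumr; apply: ler_sum => u _.
by apply: le_trans (growth _) _; rewrite -mulrA -expRD mulrBr.
Qed.

(** For each [t] there are at most [c * expR (w * (n + C - 2 * len t))] such [g]; the
sum over [t] of [expR (- 2 * w * len t)] converges, and only its tail [m <= len t]
matters. *)
Lemma conjugate_count (C e : R) : 0 < e -> exists r : nat, forall (m : R) n (S : seq G),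
  r%:R < m -> uniq S ->
  (forall g, g \in S -> len g <= n%:R /\
     exists t, m <= len t /\ len (t^-1 * g * t)%g <= len g - 2 * len t + C) ->
  (size S)%:R <= e * expR (w * n%:R).
Proof.
move=> e0; have len0 := len_ge0 act o.
pose k := c * expR (w * C); have k0 : 0 < k by rewrite mulr_gt0 ?expR_gt0.
have [r Hr] := tail_small act o (P := fun=> True)
  (fun g => expR_ge0 (- (2 * w * len g)))
  (fun S uS _ => shell_sum_double Y_proper act_proper c0 w0 growth uS) (divr_gt0 e0 k0).
exists r => m n S rm uS HS.
pose T := [seq t <- ballseq (n%:R + C) | m <= len t].
have /(uniq_leq_size uS) sub : {subset S <= [seq (t * k * t^-1)%g | t <- T, k <- ballseq (n%:R + C - 2 * len t)]}.
  move=> g /HS[gn [t [mt tgt]]]; apply/allpairsPdep; exists t, (t^-1 * g * t)%g; split.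
  - rewrite mem_filter mt mem_ballseq //=; have := len0 (t^-1 * g * t)%g; have := len0 t; lra.
  - by rewrite mem_ballseq //; lra.
  - by rewrite !mulgA mulgV mul1g mulgK.
have le1 := size_allpairs_dep_le T (fun t k => t * k * t^-1)%g (n%:R + C) (fun t => 2 * len t).
apply: le_trans (le_trans le1 _); first by rewrite ler_nat.
have -> : \sum_(u <- T) expR (- (w * (2 * len u))) = \sum_(u <- T) expR (- (2 * w * len u)).
  by apply: eq_bigr => u _; rewrite mulrCA mulrA.
have : \sum_(u <- T) expR (- (2 * w * len u)) <= e / k.
  apply: Hr; first by rewrite filter_uniq // ballseq_uniq.
  by move=> v; rewrite mem_filter => /andP[mv _]; split => //; exact: lt_le_trans mv.
rewrite ler_pdivlMr // mulrDr expRD /k => le.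
apply: le_trans (_ : _ <= ((\sum_(u <- T) expR (- (2 * w * len u))) * (c * expR (w * C))) * expR (w * n%:R)) _.
  by rewrite le_eqVlt; apply/orP; left; apply/eqP; ring.
by rewrite ler_wpM2r ?expR_ge0.
Qed.

(** Write [g = t u h]: for given [t] and [u] there are at most
[c * expR (w * (n + C - len u))] choices of [h], and [u] runs over a tail of a
convergent sum. *)
Lemma splitting_count (F : G -> Prop) (A m C e : R) : 0 < e ->
  (forall S : seq G, uniq S -> (forall v, v \in S -> F v) ->
      \sum_(v <- S) expR (- (w * len v)) <= A) ->
  exists r : nat, forall n (S : seq G), uniq S ->
  (forall g, g \in S -> len g <= n%:R /\
     exists t u, [/\ len t < m, F u, r%:R < len u &
        len u + len ((t * u)^-1 * g)%g <= len g + C]) ->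
  (size S)%:R <= e * expR (w * n%:R).
Proof.
move=> e0 conv; have len0 := len_ge0 act o.
pose k := (size (ballseq m)).+1%:R * (c * expR (w * C)).
have k0 : 0 < k by rewrite !mulr_gt0 ?expR_gt0 ?ltr0Sn.
have [r Hr] := tail_small act o (fun g => expR_ge0 (- (w * len g))) conv (divr_gt0 e0 k0).
exists r => n S uS HS.
pose U := [seq u <- ballseq (n%:R + C) | `[< F u /\ r%:R < len u >]].
pose P := [seq (u * h)%g | u <- U, h <- ballseq (n%:R + C - len u)].
have /(uniq_leq_size uS) : {subset S <= [seq (t * p)%g | t <- ballseq m, p <- P]}.
  move=> g /HS[gn [t [u [tm Fu ru tug]]]]; apply/allpairsP.
  exists (t, u * ((t * u)^-1 * g))%g; split => /=.
  - by rewrite mem_ballseq // ltW.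
  - apply/allpairsPdep; exists u, ((t * u)^-1 * g)%g; split => //.
      rewrite mem_filter; apply/andP; split; first exact/asboolP.
      by rewrite mem_ballseq //; have := len0 ((t * u)^-1 * g)%g; lra.
    by rewrite mem_ballseq //; lra.
  - by rewrite mulgA mulVKg.
rewrite size_allpairs => sub.
have leP := size_allpairs_dep_le U (fun u h => u * h)%g (n%:R + C) len.
have sumU : \sum_(u <- U) expR (- (w * len u)) <= e / k.
  apply: Hr; first by rewrite filter_uniq // ballseq_uniq.
  by move=> v; rewrite mem_filter => /andP[/asboolP].
rewrite ler_pdivlMr // in sumU.
apply: (@le_trans _ _ ((size (ballseq m))%:R * (size P)%:R)); first by rewrite -natrM ler_nat.
apply: (@le_trans _ _ ((size (ballseq m)).+1%:R * (c * expR (w * (n%:R + C)) * \sum_(u <- U) expR (- (w * len u))))).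
  by apply: ler_pM => //; rewrite ler_nat.
apply: le_trans (_ : _ <= ((\sum_(u <- U) expR (- (w * len u))) * k) * expR (w * n%:R)) _.
  by rewrite le_eqVlt; apply/orP; left; apply/eqP; rewrite /k mulrDr expRD; ring.
by rewrite ler_wpM2r ?expR_ge0.
Qed.

Lemma exp_decay (e : R) : 0 < e -> exists n0 : nat, forall n : nat, (n0 <= n)%N ->
  c * expR (w * (n%:R / 2)) <= e * expR (w * n%:R).
Proof.
move=> e0; have [n0 Hn0] := exists_nat_gt (2 * (c / e) / w); exists n0 => n nn.
have -> : w * n%:R = w * (n%:R / 2) + w * (n%:R / 2) by field.
rewrite expRD mulrA ler_pM2r ?expR_gt0 // -ler_pdivrMl // mulrC.
apply: le_trans (expR_ge1Dx _); rewrite ltr_pdivrMr // in Hn0.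
have : (n0%:R : R) * w <= n%:R * w by rewrite ler_pM2r // ler_nat.
have -> : w * (n%:R / 2) = n%:R * w / 2 by field.
lra.
Qed.

Lemma size_cover3 (T : eqType) (s : seq T) (p0 p1 p2 : pred T) :
  (forall x, x \in s -> [|| p0 x, p1 x | p2 x]) ->
  (size s <= size [seq x <- s | p0 x] + size [seq x <- s | p1 x] + size [seq x <- s | p2 x])%N.
Proof.
rewrite !size_filter; elim: s => [//|x s IH] cov /=.
have := cov x (mem_head _ _); have := IH (fun y ys => cov y (@mem_behead _ (x :: s) y ys)).
by case: (p0 x); case: (p1 x); case: (p2 x) => //=; rewrite ?add0n ?add1n; clear; lia.
Qed.

Lemma noncontracting_count (e : R) : non_elementary G -> 0 < e ->
  exists n0 : nat, forall n : nat, (n0 <= n)%N ->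
    (size [seq g <- ballseq n%:R | g \notin [set h | contracting_element act o h]])%:R
      <= e * expR (w * n%:R).
Proof.
move=> ne e0; have K1 := axis_K ax.
have [B [D [KB D0 conv]]] :=
  barrier_free_convergent isom Y_proper act_proper ax c0 w0 growth ne.
have [N [C [Nl C0 dec]]] := barrier_free_decomposition isom Y_proper act_proper ax KB D0.
have [A HA] := conv N Nl.
have e3 : 0 < e / 3 by rewrite divr_gt0.
have [r1 H1] := conjugate_count C e3; pose m : R := r1%:R + 1.
have m0 : 0 < m by rewrite ltr_wpDl.
have [r2 H2] := splitting_count m C e3 HA.
have [n3 H3] := exp_decay e3.
have [n4 H4] := exists_nat_gt (4 * (r2%:R + C + m)).
exists (maxn n3 n4) => n; rewrite geq_max => /andP[nn3 nn4].
set L := [seq g <- _ | _]; have uL : uniq L by rewrite filter_uniq // ballseq_uniq.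
have Ln g : g \in L -> len g <= n%:R /\ ~ contracting_element act o g.
  rewrite mem_filter mem_ballseq // => /andP[/negP nc gn]; split => // ct.
  by apply: nc; exact: mem_set.
pose p0 g := len g <= n%:R / 2.
pose p1 g := `[< exists t, m <= len t /\ len (t^-1 * g * t)%g <= len g - 2 * len t + C >].
pose p2 g := `[< exists t u, [/\ len t < m, barrier_free act o f N D u, r2%:R < len u &
        len u + len ((t * u)^-1 * g)%g <= len g + C] >].
have cov g : g \in L -> [|| p0 g, p1 g | p2 g].
  move=> /Ln[gn nc]; have [//|big] := boolP (p0 g).
  rewrite /p0 -ltNge in big; rewrite /=; apply/orP.
  have [ex|[t [u [tm free lu tu]]]] := dec m g m0 nc; [left; exact/asboolP|right; apply/asboolP].
  exists t, u; split => //; apply: lt_le_trans lu.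
  have : (n4%:R : R) <= n%:R by rewrite ler_nat.
  lra.
have s0 : (size [seq g <- L | p0 g])%:R <= e / 3 * expR (w * n%:R).
  apply: le_trans (H3 n nn3); apply: le_trans (growth _); rewrite ler_nat.
  apply: uniq_leq_size; first by rewrite filter_uniq.
  by move=> g; rewrite mem_filter mem_ballseq // => /andP[].
have s1 : (size [seq g <- L | p1 g])%:R <= e / 3 * expR (w * n%:R).
  apply: (H1 m); [by rewrite ltrDl|by rewrite filter_uniq|].
  by move=> g; rewrite mem_filter => /andP[/asboolP ? /Ln[]].
have s2 : (size [seq g <- L | p2 g])%:R <= e / 3 * expR (w * n%:R).
  apply: H2; first by rewrite filter_uniq.
  by move=> g; rewrite mem_filter => /andP[/asboolP ? /Ln[]].
have := size_cover3 cov; rewrite -(ler_nat R) !natrD => le.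
by apply: le_trans le _; lra.
Qed.

End Counting.

Theorem corollary1p1 (R : realType) (Y : metricType R) (G : groupType)
    (act : G -> Y -> Y) (o : Y)
    (G_countable : countable [set: G])
    (Y_proper : proper_space Y)
    (Y_geodesic : geodesic_space Y)
    (act_isometric : isometric_action act)
    (act_proper : proper_action act)
    (G_non_elementary : non_elementary G)
    (contracting_exists : exists h : G, contracting_element act o h)
    (G_peg : purely_exponential_growth act o) :
  generic act o [set h : G | contracting_element act o h].
Proof.
have [f ctr] := contracting_exists.
have [tau [K [rho [ht ax]]]] := contracting_coordinates act_isometric Y_geodesic ctr.
have [w [c1 [c2 [c10 c20 peg]]]] := peg_rate act_isometric Y_proper act_proper G_peg.
have upper (n : nat) : (size (orbit_ball_seq act o n%:R))%:R <= c2 * expR (w * n%:R).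
  by have /andP[] := peg n.
have w0 := rate_gt0 act_isometric Y_proper act_proper ax upper c20.
have growth := real_growth Y_proper act_proper w0 c20 upper.
have c0 : 0 < c2 * expR w by rewrite mulr_gt0 ?expR_gt0.
apply/cvgrPdist_le => e e0.
have [n0 Hn0] := noncontracting_count act_isometric Y_proper act_proper ax w0 c0 growth
  G_non_elementary (mulr_gt0 e0 c10).
exists n0 => // n /= nn; have bad := Hn0 n nn.
rewrite ncard_ball ncard_ballI //.
set S := [set h | _] in bad *; set b := orbit_ball_seq act o n%:R in bad *.
have b0 : 0 < ((size b)%:R : R).
  by have /andP[lo _] := peg n; apply: lt_le_trans lo; rewrite mulr_gt0 ?expR_gt0.
have split : (size b)%:R = (size [seq g <- b | g \in S])%:R + (size [seq g <- b | g \notin S])%:R :> R.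
  by rewrite !size_filter -natrD count_predC.
have -> : 1 - (size [seq g <- b | g \in S])%:R / (size b)%:R =
    (size [seq g <- b | g \notin S])%:R / (size b)%:R :> R.
  by rewrite -[X in X - _](divff (lt0r_neq0 b0)) -mulrBl {1}split addrC addKr.
rewrite ger0_norm ?divr_ge0 // ler_pdivrMr //; apply: le_trans bad _.
by rewrite -mulrA ler_pM2l //; have /andP[] := peg n.
Qed.
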